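(* Let $\{p_j\}_{j\in\mathbb{Z}_+}$ be an i.i.d. sequence in $[0,1]$ with law $\mathbb{P}$, and given $\{p_j\}$ let $X(i,j)$ be independent with $P(X(i,j)=1)=p_j=1-P(X(i,j)=0)$. Let $b=\operatorname{ess\,sup}_{\mathbb{P}}p$ and $\bar p=\mathbb{E}(p_0)$. Then for $x,y\in(0,\infty)$, $$\Psi_\rightarrow(x,y)\le bx+2\sqrt{\bar p(1-b)xy},$$ $$\Psi_\uparrow(x,y)\le\bar py+2\sqrt{\bar p(1-\bar p)xy},$$ $$\Psi(x,y)\le\bar py+4\sqrt{\bar p(1-\bar p)xy}+bx.$$
   Context: For $(k,\ell)\in\mathbb{Z}_+^2$: $\Pi_\rightarrow(k,\ell)$ is the set of paths $\{(0,y_0),(1,y_1),\dots,(k,y_k)\}$ with $0\le y_0\le\dots\le y_k\le\ell$; $\Pi_\uparrow(k,\ell)$ is the set of paths $\{(x_0,0),(x_1,1),\dots,(x_\ell,\ell)\}$ with $0\le x_0\le\dots\le x_\ell\le k$; $\Pi(k,\ell)$ is the set of nearest-neighbor paths from $(0,0)$ to $(k,\ell)$ with steps $(1,0)$ or $(0,1)$. $T_\rightarrow,T_\uparrow,T$ are the maxima of $\sum_{z\in\pi}X(z)$ over $\Pi_\rightarrow,\Pi_\uparrow,\Pi$ respectively, and $\Psi_\rightarrow,\Psi_\uparrow,\Psi$ are the almost sure limits of $n^{-1}T_\bullet(\lfloor nx\rfloor,\lfloor ny\rfloor)$. *)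

(* Defs.v *)
From HB Require Import structures.
From mathcomp Require Import all_boot all_order all_algebra.
From mathcomp Require Import all_classical all_reals all_analysis ess_sup_inf.
Set Implicit Arguments. Unset Strict Implicit. Unset Printing Implicit Defensive.
Import Order.TTheory GRing.Theory Num.Theory.
Import numFieldNormedType.Exports.
Local Open Scope classical_set_scope.
Local Open Scope ring_scope.

Definition Tright (X : nat -> nat -> bool) (k l : nat) : nat :=
  \max_(y : {ffun 'I_k.+1 -> 'I_l.+1} |
          [forall i : 'I_k.+1, forall j : 'I_k.+1, (i <= j)%N ==> (y i <= y j)%N])
     \sum_(i < k.+1) (X i (y i) : nat).

Definition Tup (X : nat -> nat -> bool) (k l : nat) : nat :=
  \max_(x : {ffun 'I_l.+1 -> 'I_k.+1} |
          [forall i : 'I_l.+1, forall j : 'I_l.+1, (i <= j)%N ==> (x i <= x j)%N])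
     \sum_(j < l.+1) (X (x j) j : nat).

(* Pi(k,l): nearest-neighbour up-right paths from (0,0) to (k,l), encoded by
   their k + l steps (true = step (1,0), false = step (0,1)), with exactly k
   steps (1,0).  After t steps the path is at (hpos s t, t - hpos s t). *)
Definition hpos (k l : nat) (s : {ffun 'I_(k + l) -> bool}) (t : nat) : nat :=
  \sum_(i < k + l | (i < t)%N) (s i : nat).

Definition Tnn (X : nat -> nat -> bool) (k l : nat) : nat :=
  \max_(s : {ffun 'I_(k + l) -> bool} | hpos s (k + l) == k)
     \sum_(t < (k + l).+1) (X (hpos s t) (t - hpos s t)%N : nat).

Definition rescaled {R : realType} (Tf : nat -> nat -> nat) (x y : R) (n : nat) : R :=
  (Tf (Num.truncn (n%:R * x)) (Num.truncn (n%:R * y)))%:R / n%:R.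

(* The random environment: (p_j)_j i.i.d. with law mu, and given p the X(i,j)
   independent Bernoulli(p_j).  Since the columns (p_j, (X(i,j))_i) are then
   i.i.d. over j, the joint law is characterised by the cylinder formula. *)
Definition random_env {R : realType} d (T : measurableType d)
  (P : probability T R) (mu : probability R R)
  (p : nat -> T -> R) (X : nat -> nat -> T -> bool) : Prop :=
  [/\ mu [set` `[0%R, 1%R]] = 1%E,
      forall j, measurable_fun setT (p j),
      forall i j, measurable [set w | X i j w] &
      forall (N : nat) (A : nat -> set R) (x : nat -> nat -> bool),
        (forall j, measurable (A j)) ->
        P [set w | forall j, (j < N)%N ->
                     A j (p j w) /\ forall i, (i < N)%N -> X i j w = x i j]
        = (\prod_(j < N)
             \int[mu]_(q in A j) (\prod_(i < N) (if x i j then q else 1 - q))%:E)%E].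

(* Main.v *)
Require Import Defs.
From HB Require Import structures.
From mathcomp Require Import all_boot all_order all_algebra.
From mathcomp Require Import all_classical all_reals all_analysis ess_sup_inf.
From mathcomp Require Import measurable_realfun.
From mathcomp Require Import ring lra zify.
Import Order.TTheory GRing.Theory Num.Theory.
Import numFieldNormedType.Exports.
Local Open Scope classical_set_scope.
Local Open Scope ring_scope.

(** A nearest-neighbour path enters each column once by a horizontal step and
    each row once by a vertical step, so T <= T_right + T_up, and T_up is T_right
    of the transposed array.  For T_right with independent Bernoulli(p) weights,
    add a boundary: Bernoulli(u) weights below and geometric(r) weights to the
    left, where p (1 - u) = r u (1 - p).  By Burke's theorem for the discrete
    queue, the increments along the top row are again independent Bernoulli(u),
    so T_right is at most a sum of independent geometric variables plus a sum of
    independent Bernoulli variables, and Chebyshev's inequality applies.  With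
    p = p_j this gives
      Psi_right <= u x + y E[p (1 - u) / (u - p)]   for ess sup p < u < 1,
      Psi_up <= x r / (1 - r) + y E[p / (p + r (1 - p))]   for 0 < r < 1;
    bounding 1 / (u - p) by 1 / (u - b), using the concavity of the second
    integrand, and optimising in u and r yields the three bounds. *)

(** * Finite expectations and Burke's theorem for one cell *)

Section Expectations.
Context {R : realFieldType}.

(** Expectation under independent Bernoulli([u i]) bits, by recursion on the first bit, so that
    identities between laws become ring computations. *)
Fixpoint Ebern n (u : nat -> R) (F : seq bool -> R) : R :=
  if n is n'.+1 then
    u 0%N * Ebern n' (fun i => u i.+1) (fun s => F (true :: s)) +
    (1 - u 0%N) * Ebern n' (fun i => u i.+1) (fun s => F (false :: s))
  else F [::].

(* Law of [minn G K], where [G] is geometric with ratio [r]. *)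
Fixpoint Egeom (r : R) K (f : nat -> R) : R :=
  if K is K'.+1 then (1 - r) * f 0%N + r * Egeom r K' (fun n => f n.+1)
  else f 0%N.

Lemma eq_Ebern n u F G : (forall s, size s = n -> F s = G s) ->
  Ebern n u F = Ebern n u G.
Proof.
elim: n u F G => [|n IH] u F G FG /=; first exact: FG.
by congr (_ * _ + _ * _); apply: IH => s ss; apply: FG; rewrite /= ss.
Qed.

Lemma Ebern_lin n u a b F G :
  Ebern n u (fun s => a * F s + b * G s) = a * Ebern n u F + b * Ebern n u G.
Proof. by elim: n u F G => [//|n IH] u F G /=; rewrite !IH; ring. Qed.

Lemma Ebern_cst n u c : Ebern n u (fun=> c) = c.
Proof. by elim: n u => [//|n IH] u /=; rewrite !IH; ring. Qed.

Lemma le_Ebern n u F G : (forall i, (i < n)%N -> 0 <= u i <= 1) ->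
  (forall s, size s = n -> F s <= G s) -> Ebern n u F <= Ebern n u G.
Proof.
elim: n u F G => [|n IH] u F G u01 FG /=; first exact: FG.
have /andP[u0 u1] := u01 0%N isT.
by apply: lerD; apply: ler_wpM2l; rewrite ?subr_ge0 //;
  apply: IH => [i ilt|s ss]; [exact: u01|apply: FG; rewrite /= ss
  |exact: u01|apply: FG; rewrite /= ss].
Qed.

Lemma Ebern_take n k u F : (k <= n)%N ->
  Ebern n u (fun s => F (take k s)) = Ebern k u F.
Proof.
elim: n k u F => [|n IH] [|k] u F //= kn.
  by rewrite Ebern_cst; ring.
by rewrite (IH k _ (fun s => F (true :: s))) // (IH k _ (fun s => F (false :: s))).
Qed.

Lemma eq_Egeom r K f g : f =1 g -> Egeom r K f = Egeom r K g.
Proof.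
elim: K f g => [|K IH] f g fg /=; first exact: fg.
by rewrite fg (IH _ (fun n => g n.+1)).
Qed.

Lemma Egeom_lin r K a b f g :
  Egeom r K (fun n => a * f n + b * g n) = a * Egeom r K f + b * Egeom r K g.
Proof. by elim: K f g => [//|K IH] f g /=; rewrite !IH; ring. Qed.

Lemma Egeom_cst r K c : Egeom r K (fun=> c) = c.
Proof. by elim: K => [//|K IH] /=; rewrite !IH; ring. Qed.

Lemma le_Egeom r K f g : 0 <= r <= 1 -> (forall n, f n <= g n) ->
  Egeom r K f <= Egeom r K g.
Proof.
move=> /andP[r0 r1]; elim: K f g => [|K IH] f g fg /=; first exact: fg.
by apply: lerD; apply: ler_wpM2l; rewrite ?subr_ge0 //; apply: IH.
Qed.

(** A function constant from [M] on depends only on [minn G M], so every higher truncation level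
    gives the same mean. *)
Lemma Egeom_stable r M K f : (M <= K)%N ->
  (forall n, (M <= n)%N -> f n = f M) -> Egeom r K f = Egeom r M f.
Proof.
elim: K M f => [|K IH] [|M] f //= MK fM.
  by rewrite (@eq_Egeom _ _ _ (fun=> f 0%N)) => [|n]; rewrite ?Egeom_cst ?fM //; ring.
by rewrite (IH M) // => n Mn; rewrite fM.
Qed.

Lemma Ebern_Egeom n u r K (F : seq bool -> nat -> R) :
  Ebern n u (fun s => Egeom r K (F s)) = Egeom r K (fun c => Ebern n u (fun s => F s c)).
Proof.
by elim: n u F => [//|n IH] u F /=; rewrite !IH Egeom_lin.
Qed.

(* Burke's theorem for one cell: if the queue length, the service and the
   arrival have law geometric(r) * Bernoulli(u) * Bernoulli(p), then the new
   length and the output have law geometric(r) * Bernoulli(u). *)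
Lemma burke_cell (p u r : R) M (h : nat -> bool -> R) :
  p * (1 - u) = r * u * (1 - p) ->
  (forall n c, (M <= n)%N -> h n c = h M c) ->
  Egeom r M.+1 (fun n =>
    u * (p * h n true + (1 - p) * h n.-1 (n == 0%N)) +
    (1 - u) * (p * h n.+1 true + (1 - p) * h n false)) =
  u * Egeom r M (h^~ true) + (1 - u) * Egeom r M (h^~ false).
Proof.
move=> pur hM.
have st c K : (M <= K)%N -> Egeom r K (h^~ c) = Egeom r M (h^~ c).
  by move=> MK; apply: Egeom_stable => // n Mn; apply: hM.
rewrite (@eq_Egeom _ _ _ (fun n => 1 * ((u * p) * h n true + (1 - u) * p * h n.+1 true)
  + 1 * ((1 - u) * (1 - p) * h n false + u * (1 - p) * h n.-1 (n == 0%N)))); last first.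
  by move=> n; ring.
rewrite !Egeom_lin.
(* Both identities split off the event that the geometric variable is 0; on the complement, the
   variable minus 1 is again geometric. *)
have e1 : Egeom r M.+1 (fun n => h n.-1 (n == 0%N)) =
   (1 - r) * h 0%N true + r * Egeom r M (h^~ false) by [].
have e2 : Egeom r M (h^~ true) =
   (1 - r) * h 0%N true + r * Egeom r M.+1 (fun n => h n.+1 true).
  by rewrite -(st true M.+2) // leqW.
rewrite e1 !st ?leqnSn //.
move: e2; set A := Egeom r M.+1 _; set B := Egeom r M (h^~ true) => e2.
set D := Egeom r M (h^~ false).
(* Burke's relation makes the two terms in [h 0%N true] cancel. *)
have -> : (1 - u) * p * A = u * (1 - p) * (r * A).
  by rewrite (mulrC (1 - u)) pur; ring.
have -> : r * A = B - (1 - r) * h 0%N true by rewrite e2; ring.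
transitivity (u * B + ((1 - u) * (1 - p) + r * u * (1 - p)) * D); first by ring.
by rewrite -pur; ring.
Qed.

End Expectations.

(** * The queue recursion and the comparison with last-passage times *)

(* A queue of initial length [c] with services [I] and arrivals [x]; the truncated
   subtraction is the reflection at 0.  The output records the arrivals and the
   unused services, so that the length plus the services so far equals [c] plus
   the output so far. *)
Fixpoint queue_output (c : nat) (I x : seq bool) : seq bool :=
  if I is i :: I' then if x is a :: x' then
    (a || i && (c == 0%N)) :: queue_output (c + a - i)%N I' x'
  else [::] else [::].

Lemma size_queue_output c I x : size x = size I -> size (queue_output c I x) = size I.
Proof. by elim: I c x => [|i I IH] c [|a x] //= [e]; rewrite IH. Qed.

(** With at least as many customers as time steps, no service meets an empty queue, and the output
    is the arrival sequence. *)
Lemma queue_output_stable c c' I x : (size I <= c)%N -> (size I <= c')%N ->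
  queue_output c I x = queue_output c' I x.
Proof.
elim: I c c' x => [//|i I IH] c c' [|a x] //= h h'.
have [-> ->] : (c == 0%N) = false /\ (c' == 0%N) = false by split; lia.
by congr (_ :: _); apply: IH; case: a; case: i; lia.
Qed.

(** In the array, the horizontal increment along the new row is at least the weight of the cell. *)
Lemma queue_output_ge c I x b : size x = size I ->
  (nth false x b <= nth false (queue_output c I x) b)%N.
Proof.
elim: I c x b => [|i I IH] c [|a x] [|b] //= [e]; first by case: a.
exact: IH.
Qed.

(** The queue length, [c] plus outputs minus services so far, is never negative; in the array,
    moving up one row does not lower the passage time. *)
Lemma queue_ge0 c I x b : size x = size I ->
  (count id (take b I) <= c + count id (take b (queue_output c I x)))%N.
Proof.
elim: I c x b => [|i I IH] c [|a x] [|b] //= [e].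
have := IH (c + a - i)%N x b e.
by case: a; case: i; case: c => [|c] /=; lia.
Qed.

Lemma count_take_S (s : seq bool) b :
  count id (take b.+1 s) = (count id (take b s) + nth false s b)%N.
Proof. by elim: s b => [|i s IH] [|b] //=; rewrite ?take0 ?IH /=; lia. Qed.

(** Queues in tandem: the output of each row provides the services of the next, and the last output
    is the sequence of increments along the top row. *)
Fixpoint top (ns : seq nat) (m : seq (seq bool)) (I : seq bool) : seq bool :=
  if ns is n :: ns' then if m is x :: m' then top ns' m' (queue_output n I x)
  else I else I.

Lemma top_rcons ns m n x I : size m = size ns ->
  top (rcons ns n) (rcons m x) I = queue_output n (top ns m I) x.
Proof. by elim: ns m I => [|n' ns IH] [|x' m] I //= [e]; rewrite IH. Qed.

Lemma size_top ns m I : size m = size ns -> all (fun x => size x == size I) m ->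
  size (top ns m I) = size I.
Proof.
elim: ns m I => [|n ns IH] [|x m] I //= [e] /andP[/eqP sx am].
have sd := size_queue_output n _ _ sx.
by rewrite IH ?sd // (eq_all (a2 := fun y => size y == size I)) // => y; rewrite sd.
Qed.

(** [m] lists the rows from the bottom up, while the arguments keep the order column, row of [X]. *)
Definition entries (m : seq (seq bool)) (i j : nat) : bool := nth false (nth [::] m j) i.

Section Stationary.
Variables (ns : seq nat) (m : seq (seq bool)) (I : seq bool).
Hypothesis smn : size m = size ns.
Hypothesis sm : all (fun x => size x == size I) m.

Let rowI j := top (take j ns) (take j m) I.
(* Last-passage time to [(i - 1, j - 1)] with boundary weights [ns] and [I]. *)
Let H i j := (sumn (take j ns) + count id (take i (rowI j)))%N.

Let size_rowI j : size (rowI j) = size I.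
Proof.
apply: size_top; first by rewrite !size_take smn.
by apply/allP => y /mem_take; move/allP: sm; apply.
Qed.

Let rowI_S j : (j < size ns)%N ->
  rowI j.+1 = queue_output (nth 0%N ns j) (rowI j) (nth [::] m j).
Proof.
move=> jn; rewrite /rowI (take_nth 0%N) // (take_nth [::]) ?smn //.
by rewrite top_rcons // !size_take smn.
Qed.

Let size_row j : (j < size ns)%N -> size (nth [::] m j) = size (rowI j).
Proof.
by move=> jn; rewrite size_rowI; apply/eqP; move/all_nthP: sm; apply; rewrite smn.
Qed.

Let H_S i j : (j < size ns)%N -> (H i j <= H i j.+1)%N.
Proof.
move=> jn; rewrite /H rowI_S // (take_nth 0%N) // sumn_rcons -addnA leq_add2l.
exact: queue_ge0 (size_row _ jn).
Qed.

Let H_mono i j j' : (j <= j')%N -> (j' <= size ns)%N -> (H i j <= H i j')%N.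
Proof.
elim: j' => [|j' IH]; first by rewrite leqn0 => /eqP ->.
rewrite leq_eqVlt => /predU1P[-> //|]; rewrite ltnS => jj jn.
exact: leq_trans (IH jj (ltnW jn)) (H_S _ _ jn).
Qed.

(** Along a path, each weight is at most the horizontal increment of [H] in its column and row, and
    climbing never lowers [H]. *)
Lemma Tright_le_stationary k l : size I = k.+1 -> size ns = l.+1 ->
  (Tright (entries m) k l <= sumn ns + count id (top ns m I))%N.
Proof.
move=> sI sn; apply/bigmax_leqP => y /forallP ym.
have Hend : (sumn ns + count id (top ns m I))%N = H k.+1 l.+1.
  rewrite /H /rowI (take_oversize (s := ns)) ?sn //.
  rewrite (take_oversize (s := m)) ?smn ?sn // take_oversize //.
  by rewrite size_top // sI.
rewrite Hend.
(* [H i j] accounts for [j] complete rows, so the row of index [y i] is included from [j = (y i).+1]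
   on. *)
pose Y i := (y (inord i)).+1.
suff step : forall i, (i <= k)%N ->
    (\sum_(i' < i.+1) entries m i' (y (inord i')) <= H i.+1 (Y i))%N.
  apply: leq_trans (H_mono k.+1 (Y k) l.+1 _ _); rewrite ?sn //; last exact: ltn_ord.
  by apply: leq_trans (step k (leqnn _)); apply: leq_sum => i _; rewrite inord_val.
have xle i : (i <= k)%N -> (entries m i (y (inord i)) <= nth false (rowI (Y i)) i)%N.
  move=> ik; rewrite /Y rowI_S ?sn //.
  by apply: queue_output_ge; apply: size_row; rewrite sn.
have Hi i j : H i.+1 j = (H i j + nth false (rowI j) i)%N.
  by rewrite /H count_take_S addnA.
elim=> [|i IH] ik.
  rewrite big_ord1 Hi; apply: leq_trans (xle 0%N isT) _; exact: leq_addl.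
rewrite big_ord_recr /= Hi leq_add ?xle //.
apply: leq_trans (IH (ltnW ik)) _; apply: H_mono; last by rewrite sn ltn_ord.
have /forallP/(_ (inord i.+1)) := ym (inord i).
by rewrite !inordK ?ltnS ?(ltnW ik) // leqnSn.
Qed.

End Stationary.

(** * Quenched estimates: stationarity and second moments *)

Section Quenched.
Context {R : realFieldType}.

(** After the first cell, the queue length is again geometric([r]) and independent of the output
    bit, so the remaining cells follow by induction. *)
Lemma burke_row n K (u p : nat -> R) (r : R) F : (n <= K)%N ->
  (forall i, (i < n)%N -> p i * (1 - u i) = r * u i * (1 - p i)) ->
  Egeom r K (fun c => Ebern n u (fun I => Ebern n p (fun x => F (queue_output c I x))))
  = Ebern n u F.
Proof.
elim: n K u p F => [|n IH] K u p F nK pur; first by rewrite /= Egeom_cst.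
have st c c' : (n.+1 <= c)%N -> (n.+1 <= c')%N ->
    Ebern n.+1 u (fun I => Ebern n.+1 p (fun x => F (queue_output c I x))) =
    Ebern n.+1 u (fun I => Ebern n.+1 p (fun x => F (queue_output c' I x))).
  move=> nc nc'; apply: eq_Ebern => I sI; apply: eq_Ebern => x sx.
  by rewrite (queue_output_stable c c') ?sI.
(* Longer queues give the same output, so the truncation can be lowered to the level required by
   [burke_cell]. *)
rewrite (Egeom_stable _ n.+1) //; last by move=> c nc; apply: st.
pose H c b := Ebern n (fun i => u i.+1) (fun I =>
  Ebern n (fun i => p i.+1) (fun x => F (b :: queue_output c I x))).
have HM c b : (n <= c)%N -> H c b = H n b.
  move=> nc; apply: eq_Ebern => I sI; apply: eq_Ebern => x sx.
  by rewrite (queue_output_stable c n) ?sI.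
have := burke_cell (p 0%N) (u 0%N) r n H (pur 0%N isT) HM.
set B := (X in _ = X -> _) => cellE.
transitivity B.
  rewrite -cellE; apply: eq_Egeom => c /=; rewrite !Ebern_lin /H.
  by case: c => [|c]; rewrite /= ?addn1 ?addn0 ?subn0 ?subn1 /= ?addn0.
by rewrite /B /H /=; congr (_ * _ + _ * _);
  rewrite -[RHS](IH n _ (fun i => p i.+1)) // => i ilt; apply: pur.
Qed.

Fixpoint Emat L n (p : nat -> nat -> R) (F : seq (seq bool) -> R) : R :=
  if L is L'.+1 then
    Ebern n (p 0%N) (fun x => Emat L' n (fun a => p a.+1) (fun m => F (x :: m)))
  else F [::].

Fixpoint Egeoms L K (r : nat -> R) (F : seq nat -> R) : R :=
  if L is L'.+1 then
    Egeom (r 0%N) K (fun c => Egeoms L' K (fun a => r a.+1) (fun ns => F (c :: ns)))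
  else F [::].

(** Boundary weights and rows are drawn alternately, in the order in which [top] consumes them. *)
Fixpoint Ejoint L n K (p : nat -> nat -> R) (r : nat -> R)
    (F : seq nat -> seq (seq bool) -> R) : R :=
  if L is L'.+1 then
    Egeom (r 0%N) K (fun c => Ebern n (p 0%N) (fun x =>
      Ejoint L' n K (fun a => p a.+1) (fun a => r a.+1)
        (fun ns m => F (c :: ns) (x :: m))))
  else F [::] [::].

Definition shaped L n (m : seq (seq bool)) := (size m == L) && all (fun x => size x == n) m.

Lemma le_Ejoint L n K p r F G :
  (forall a i, (a < L)%N -> (i < n)%N -> 0 <= p a i <= 1) ->
  (forall a, (a < L)%N -> 0 <= r a <= 1) ->
  (forall ns m, size ns = L -> shaped L n m -> F ns m <= G ns m) ->
  Ejoint L n K p r F <= Ejoint L n K p r G.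
Proof.
elim: L p r F G => [|L IH] p r F G p01 r01 FG /=; first exact: FG.
apply: le_Egeom => [|c]; first exact: r01.
apply: le_Ebern => [i|x sx]; first exact: p01.
apply: IH => [a i aL|a aL|ns m sns /andP[/eqP sm am]]; [exact: p01|exact: r01|].
by apply: FG; rewrite /= ?sns // /shaped /= sm sx !eqxx.
Qed.

Lemma eq_Ejoint L n K p r F G : (forall ns m, F ns m = G ns m) ->
  Ejoint L n K p r F = Ejoint L n K p r G.
Proof.
elim: L p r F G => [|L IH] p r F G FG /=; first exact: FG.
by apply: eq_Egeom => c; apply: eq_Ebern => x _; apply: IH => *.
Qed.

Lemma Ejoint_lin L n K p r a b F G :
  Ejoint L n K p r (fun ns m => a * F ns m + b * G ns m) =
  a * Ejoint L n K p r F + b * Ejoint L n K p r G.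
Proof.
elim: L p r F G => [//|L IH] p r F G /=; rewrite -Egeom_lin.
by apply: eq_Egeom => c; rewrite -Ebern_lin; apply: eq_Ebern => x _; rewrite IH.
Qed.

Lemma Ejoint_mat L n K p r F : Ejoint L n K p r (fun=> F) = Emat L n p F.
Proof.
elim: L p r F => [//|L IH] p r F /=.
transitivity (Egeom (r 0%N) K (fun=> Emat L.+1 n p F)); last exact: Egeom_cst.
by apply: eq_Egeom => c; apply: eq_Ebern => x _; rewrite IH.
Qed.

Lemma Ejoint_geoms L n K p r F : Ejoint L n K p r (fun ns _ => F ns) = Egeoms L K r F.
Proof.
elim: L p r F => [//|L IH] p r F /=; apply: eq_Egeom => c.
by under eq_Ebern => x _ do rewrite IH; rewrite Ebern_cst.
Qed.

(** One use of [burke_row] per row: each output is again Bernoulli([u]) and serves the next row. *)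
Lemma Ejoint_top L n K (p : nat -> nat -> R) r (u : nat -> R) F : (n <= K)%N ->
  (forall a i, (a < L)%N -> (i < n)%N -> p a i * (1 - u i) = r a * u i * (1 - p a i)) ->
  Ebern n u (fun I => Ejoint L n K p r (fun ns m => F (top ns m I))) = Ebern n u F.
Proof.
move=> nK; elim: L p r => [//|L IH] p r pur /=.
rewrite -[RHS](IH (fun a => p a.+1) (fun a => r a.+1)); last by move=> a i aL; apply: pur.
rewrite -[RHS](burke_row n K u (p 0%N) (r 0%N)) //; last by move=> i; apply: pur.
by rewrite Ebern_Egeom.
Qed.

(** Variance plus squared bias; the centre [c] is arbitrary because each bit shifts it in the
    induction. *)
Lemma Ebern_sqr n (u : nat -> R) c :
  Ebern n u (fun s => ((count id s)%:R - c) ^+ 2) =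
  \sum_(i < n) u i * (1 - u i) + (\sum_(i < n) u i - c) ^+ 2.
Proof.
elim: n u c => [|n IH] u c /=; first by rewrite !big_ord0; ring.
under [X in u 0%N * X]eq_Ebern => s _ do
  rewrite add1n -natr1 -addrA -[1 - c]opprB.
under [X in (1 - u 0%N) * X]eq_Ebern => s _ do rewrite add0n.
by rewrite !IH !big_ord_recl /=; ring.
Qed.

Definition gmean (r : R) K := Egeom r K (fun c => c%:R).
Definition gsqr (r : R) K := Egeom r K (fun c => c%:R ^+ 2).

(** The same decomposition, with each variance bounded by the second moment. *)
Lemma Egeoms_sqr L K (r : nat -> R) c : (forall a, (a < L)%N -> 0 <= r a <= 1) ->
  Egeoms L K r (fun ns => ((sumn ns)%:R - c) ^+ 2) <=
  \sum_(a < L) gsqr (r a) K + (\sum_(a < L) gmean (r a) K - c) ^+ 2.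
Proof.
elim: L r c => [|L IH] r c r01 /=; first by rewrite !big_ord0 /=; nra.
set V := \sum_(a < L) gsqr (r a.+1) K; set M := \sum_(a < L) gmean (r a.+1) K.
apply: (@le_trans _ _ (Egeom (r 0%N) K (fun n => 1 * (V + (M - c) ^+ 2) +
    1 * (2 * (M - c) * n%:R + 1 * n%:R ^+ 2)))).
  apply: le_Egeom => [|n]; first exact: r01.
  have := IH (fun a => r a.+1) (c - n%:R) (fun a => r01 a.+1).
  rewrite -/V -/M => IHn; apply: le_trans (le_trans IHn _); last first.
    by rewrite le_eqVlt; apply/orP; left; apply/eqP; ring.
  by rewrite -!(Ejoint_geoms L 0 K (fun _ _ => 0)) (eq_Ejoint _ _ _ _ _ _
     (fun ns _ => ((sumn ns)%:R - (c - n%:R)) ^+ 2)) // => ns _; rewrite natrD; ring.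
rewrite !Egeom_lin Egeom_cst !big_ord_recl /= -/V -/M -/(gmean _ _) -/(gsqr _ _).
set g := gmean _ _; set q := gsqr _ _; have := sqr_ge0 g; nra.
Qed.

Lemma gmean_S r K : gmean r K.+1 = r * (gmean r K + 1).
Proof.
rewrite /gmean /= mulr0 add0r; congr (_ * _).
transitivity (Egeom r K (fun n => 1 * n%:R + 1 * 1)).
  by apply: eq_Egeom => n; rewrite -natr1; ring.
by rewrite Egeom_lin Egeom_cst; ring.
Qed.

Lemma gsqr_S r K : gsqr r K.+1 = r * (gsqr r K + 2 * gmean r K + 1).
Proof.
rewrite /gsqr /= expr0n mulr0 add0r; congr (_ * _).
transitivity (Egeom r K (fun n => 1 * n%:R ^+ 2 + 1 * (2 * n%:R + 1 * 1))).
  by apply: eq_Egeom => n; rewrite -natr1; ring.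
by rewrite !Egeom_lin Egeom_cst /gmean; ring.
Qed.

Lemma gmean_ge0 r K : 0 <= r -> 0 <= gmean r K.
Proof.
move=> r0; elim: K => [//|K IH].
by rewrite gmean_S mulr_ge0 // addr_ge0.
Qed.

Lemma gmean_le r K : 0 <= r -> r < 1 -> gmean r K <= r / (1 - r).
Proof.
move=> r0 r1; have s0 : 0 < 1 - r by rewrite subr_gt0.
elim: K => [|K IH]; first by rewrite /gmean /= divr_ge0 // ltW.
rewrite gmean_S; apply: le_trans (ler_wpM2l r0 (lerD IH (lexx 1))) _.
by rewrite le_eqVlt; apply/orP; left; apply/eqP; field; rewrite gt_eqF.
Qed.

(** Without truncation the second moment is r (1 + r) / (1 - r)^2. The bound in terms of [s] is
    uniform over the rows of a random environment. *)
Lemma gsqr_le r s K : 0 <= r -> r <= s -> s < 1 -> gsqr r K <= 2 / (1 - s) ^+ 2.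
Proof.
move=> r0 rs s1; have s0 : 0 < 1 - s by rewrite subr_gt0.
have r1 : r < 1 by apply: le_lt_trans s1.
have t0 : 0 < 1 - r by rewrite subr_gt0.
apply: (@le_trans _ _ (2 / (1 - r) ^+ 2)); last first.
  rewrite ler_pM2l // lef_pV2 ?posrE ?exprn_gt0 //.
  by rewrite ler_sqr ?nnegrE ?(ltW s0) ?(ltW t0) // lerD2l lerN2.
elim: K => [|K IH]; first by rewrite /gsqr /= expr0n divr_ge0 // exprn_ge0 // ltW.
rewrite gsqr_S; have := gmean_le r K r0 r1.
move: IH; set a := gsqr _ _; set g := gmean _ _ => IH gle.
apply: (@le_trans _ _ (r * (2 / (1 - r) ^+ 2 + 2 * (r / (1 - r)) + 1))).
  by apply: ler_wpM2l => //; lra.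
rewrite -subr_ge0.
have -> : 2 / (1 - r) ^+ 2 - r * (2 / (1 - r) ^+ 2 + 2 * (r / (1 - r)) + 1) =
  (1 - r) * (1 - r) * (2 + r) / (1 - r) ^+ 2.
  by field; rewrite gt_eqF.
by apply: divr_ge0; [apply: mulr_ge0; [apply: mulr_ge0|]; lra | apply: exprn_ge0; lra].
Qed.

(** On [Q] the left boundary and the top row together exceed [c1 + c2] by at least [e]. The
    inequality (a + b)^2 <= 2 a^2 + 2 b^2 then lets only their two marginal laws enter. *)
Lemma quenched_chebyshev L n K (p : nat -> nat -> R) (r u : nat -> R)
    (Q : pred (seq (seq bool))) c1 c2 e :
  (n <= K)%N -> 0 <= e ->
  (forall a i, (a < L)%N -> (i < n)%N -> 0 <= p a i <= 1) ->
  (forall a, (a < L)%N -> 0 <= r a <= 1) ->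
  (forall i, (i < n)%N -> 0 <= u i <= 1) ->
  (forall a i, (a < L)%N -> (i < n)%N -> p a i * (1 - u i) = r a * u i * (1 - p a i)) ->
  (forall ns I m, size ns = L -> size I = n -> shaped L n m -> Q m ->
     c1 + c2 + e <= (sumn ns + count id (top ns m I))%:R) ->
  e ^+ 2 * Emat L n p (fun m => (Q m)%:R) <=
  2 * (\sum_(a < L) gsqr (r a) K + (\sum_(a < L) gmean (r a) K - c1) ^+ 2) +
  2 * (\sum_(i < n) u i * (1 - u i) + (\sum_(i < n) u i - c2) ^+ 2).
Proof.
move=> nK e0 p01 r01 u01 pur QP.
rewrite -Ebern_sqr.
apply: le_trans (lerD (ler_wpM2l (ler0n _ 2) (Egeoms_sqr L K r c1 r01)) (lexx _)).
(* All terms are put under one expectation over [I], the boundary and the array, where the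
   inequality holds pointwise. *)
rewrite -(Ebern_cst n u (e ^+ 2 * _)).
rewrite -[X in 2 * X + _](Ebern_cst n u) -[X in _ + _ * X](Ejoint_top L n K p r u) //.
rewrite -Ebern_lin.
apply: le_Ebern => // I sI.
rewrite -(Ejoint_geoms L n K p r) -(Ejoint_mat L n K p r) -Ejoint_lin.
have -> : e ^+ 2 * Ejoint L n K p r (fun=> fun m => (Q m)%:R) =
   Ejoint L n K p r (fun ns m => e ^+ 2 * (Q m)%:R + 0 * 0).
  by rewrite Ejoint_lin mul0r addr0.
apply: le_Ejoint => // ns m sns sm.
case Qm: (Q m); last first.
  by rewrite mulr0 mul0r addr0 addr_ge0 // mulr_ge0 // sqr_ge0.
have := QP ns I m sns sI sm Qm; rewrite natrD mulr1 mul0r addr0.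
set A := (sumn ns)%:R; set B := (count _ _)%:R => h.
apply: (@le_trans _ _ ((A - c1 + (B - c2)) ^+ 2)).
  by rewrite ler_sqr ?nnegrE //; lra.
by have := sqr_ge0 (A - c1 - (B - c2)); nra.
Qed.

End Quenched.

(** * Enumeration of finite 0-1 arrays *)

Fixpoint bseqs n : seq (seq bool) :=
  if n is n'.+1 then [seq true :: s | s <- bseqs n'] ++ [seq false :: s | s <- bseqs n']
  else [:: [::]].

Fixpoint mats L n : seq (seq (seq bool)) :=
  if L is L'.+1 then [seq x :: m | x <- bseqs n, m <- mats L' n] else [:: [::]].

Lemma mem_bseqs s : s \in bseqs (size s).
Proof.
elim: s => [//|b s IH] /=; rewrite mem_cat; apply/orP.
by case: b; [left|right]; apply: map_f.
Qed.

Lemma mem_mats L n m : shaped L n m -> m \in mats L n.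
Proof.
move=> /andP[/eqP <-]; elim: m => [//|x m IH] /= /andP[/eqP sx /IH mm].
by apply/allpairsP; exists (x, m); rewrite /= -{1}sx mem_bseqs mm.
Qed.

Section Enumeration.
Context {R : realFieldType}.

Lemma Ebern_sum n (u : nat -> R) F :
  Ebern n u F = \sum_(s <- bseqs n)
    (\prod_(i < n) (if nth false s i then u i else 1 - u i)) * F s.
Proof.
elim: n u F => [|n IH] u F /=; first by rewrite big_seq1 big_ord0 mul1r.
rewrite big_cat !big_map /= !IH !big_distrr /=.
by congr (_ + _); apply: eq_bigr => s _; rewrite big_ord_recl /= mulrA.
Qed.

Lemma Emat_sum L n (p : nat -> nat -> R) F :
  Emat L n p F = \sum_(m <- mats L n)
    (\prod_(a < L) \prod_(i < n) (if entries m i a then p a i else 1 - p a i)) * F m.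
Proof.
elim: L p F => [|L IH] p F /=; first by rewrite big_seq1 big_ord0 mul1r.
rewrite big_allpairs_dep Ebern_sum; apply: eq_bigr => x _.
rewrite IH big_distrr /=; apply: eq_bigr => m _.
by rewrite big_ord_recl /= mulrA.
Qed.

Lemma Emat_cst L n (p : nat -> nat -> R) c : Emat L n p (fun=> c) = c.
Proof.
elim: L p => [//|L IH] p /=.
by under eq_Ebern => x _ do rewrite IH; rewrite Ebern_cst.
Qed.

(** Entries outside the leading block integrate to 1. This passes to the square arrays of the
    cylinder formula. *)
Lemma Emat_take N L N' n (p : nat -> nat -> R) F : (L <= N)%N -> (n <= N')%N ->
  Emat N N' p (fun m => F (map (take n) (take L m))) = Emat L n p F.
Proof.
move=> LN nN; elim: N L LN p F => [|N IH] [|L] //= LN p F.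
  by under eq_Ebern => x _ do rewrite Emat_cst; rewrite Ebern_cst.
under eq_Ebern => x _ do rewrite (IH L LN _ (fun m => F (take n x :: m))).
exact: (Ebern_take _ _ _ (fun x => Emat L n _ (fun m => F (x :: m)))).
Qed.

End Enumeration.

(** * Path combinatorics *)

Lemma Tright_local X Y k l :
  (forall i j, (i <= k)%N -> (j <= l)%N -> X i j = Y i j) -> Tright X k l = Tright Y k l.
Proof.
move=> XY; apply: eq_bigr => y _; apply: eq_bigr => i _.
by rewrite XY // -ltnS ltn_ord.
Qed.

Lemma Tright_le X k l : (Tright X k l <= k.+1)%N.
Proof.
apply/bigmax_leqP => y _; rewrite -[leqRHS]card_ord -sum1_card.
by apply: leq_sum => i _; case: (X _ _).
Qed.

Lemma Tup_Tright X k l : Tup X k l = Tright (fun i j => X j i) l k.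
Proof. by []. Qed.

Lemma le_Tright (X : nat -> nat -> bool) k l (y : nat -> nat) :
  {homo y : i j / (i <= j)%N} -> (forall i, (y i <= l)%N) ->
  (\sum_(i < k.+1) X i (y i) <= Tright X k l)%N.
Proof.
move=> ym yl.
pose f : {ffun 'I_k.+1 -> 'I_l.+1} := [ffun i : 'I_k.+1 => inord (y i)].
have fE (i : 'I_k.+1) : f i = y i :> nat by rewrite ffunE inordK // ltnS.
have := @leq_bigmax_cond _ (fun y : {ffun 'I_k.+1 -> 'I_l.+1} =>
  [forall i : 'I_k.+1, forall j : 'I_k.+1, (i <= j)%N ==> (y i <= y j)%N])
  (fun y => \sum_(i < k.+1) (X i (y i) : nat)) f.
move=> h; apply: leq_trans (h _); last first.
  by apply/forallP => i; apply/forallP => j; apply/implyP => ij; rewrite !fE ym.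
by apply: leq_sum => i _; rewrite fE.
Qed.

(* Every vertex of an up-right path other than the origin is entered either
   horizontally, which happens once in each column, or vertically, which
   happens once in each row. *)
Lemma Tnn_le X k l : (Tnn X k l <= Tright X k l + Tup X k l)%N.
Proof.
apply/bigmax_leqP => s /eqP sk.
have hpos_S (t : 'I_(k + l)) : hpos s t.+1 = (hpos s t + s t)%N.
  rewrite /hpos (bigD1 t) //= addnC; congr (_ + _)%N; apply: eq_bigl => i.
  by rewrite ltnS ltn_neqAle andbC.
have hpos_le t : (hpos s t <= t)%N.
  have [tkl|] := leqP t (k + l); last first.
    move=> kt; apply: leq_trans (ltnW kt).
    rewrite -[leqRHS]card_ord -sum1_card /hpos big_mkcond /=.
    by apply: leq_sum => i _; case: ifP => //; case: (s i).
  elim: t tkl => [|t IH] tkl; first by rewrite /hpos big1.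
  by rewrite (hpos_S (Ordinal tkl)) /=; have := IH (ltnW tkl); case: (s _); lia.
(* Induction on the steps: [y] and [x] record the heights of entry into the columns and the
   abscissas of entry into the rows so far. The origin is counted in both sums. *)
suff main : forall t, (t <= k + l)%N -> exists y x : nat -> nat,
  [/\ {homo y : i j / (i <= j)%N}, {homo x : i j / (i <= j)%N},
      forall i, (y i <= t - hpos s t)%N, forall j, (x j <= hpos s t)%N &
      (\sum_(t' < t.+1) (X (hpos s t') (t' - hpos s t')%N : nat) <=
       \sum_(i < (hpos s t).+1) X i (y i) + \sum_(j < (t - hpos s t).+1) X (x j) j)%N].
  have [y [x [ym xm yl xk le]]] := main (k + l)%N (leqnn _).
  move: yl xk le; rewrite sk addKn => yl xk le.
  apply: leq_trans le (leq_add _ _); first exact: le_Tright.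
  by rewrite Tup_Tright; apply: (le_Tright (fun i j => X j i)).
elim=> [|t IH] tkl.
  exists (fun=> 0%N), (fun=> 0%N).
  have h0 : hpos s 0 = 0%N by rewrite /hpos big1.
  by split; rewrite ?h0 // !big_ord1 h0 leq_addr.
have [y [x [ym xm yl xk le]]] := IH (ltnW tkl).
have hS := hpos_S (Ordinal tkl); rewrite /= in hS.
have ht := hpos_le t.
(* A horizontal step enters a new column at the current height and extends [y]; a vertical step
   extends [x]. *)
case st: (s _) hS => /= hS; rewrite ?addn1 ?addn0 in hS.
  exists (fun i => if (i < (hpos s t).+1)%N then y i else (t - hpos s t)%N), x.
  have v : (t.+1 - hpos s t.+1 = t - hpos s t)%N by rewrite hS subSS.
  split; rewrite ?v //.
  - move=> i j ij; case: ltnP => hi; case: ltnP => hj //; [exact: ym|lia].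
  - by move=> i; case: ifP.
  - by move=> j; rewrite hS; apply: leqW.
  - rewrite big_ord_recr /= v hS [X in (_ <= X + _)%N]big_ord_recr /= ltnn.
    rewrite addnAC leq_add2r; apply: leq_trans le _; rewrite leq_add2r.
    by apply: leq_sum => i _; rewrite ltn_ord.
exists y, (fun j => if (j < (t - hpos s t).+1)%N then x j else hpos s t).
split; rewrite ?hS ?subSn //.
- move=> i j ij; case: ltnP => hi; case: ltnP => hj //; [exact: xm|lia].
- by move=> i; apply: leqW.
- by move=> j; case: ifP.
- rewrite big_ord_recr /= hS subSn // [X in (_ <= _ + X)%N]big_ord_recr /= ltnn.
  rewrite addnA leq_add2r; apply: leq_trans le _; rewrite leq_add2l.
  by apply: leq_sum => i _; rewrite ltn_ord.
Qed.

(** * Averaging over the environment *)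

Section Annealing.
Context {R : realType} (mu : probability R R) (D : set R).
Hypotheses (mD : measurable D) (muD : mu D = 1%E).

(** Bounded measurable functions on [D]: a class closed under sums and products, inside which
    integrability is automatic. *)
Definition bmf (f : R -> R) :=
  measurable_fun D f /\ exists M, forall q, D q -> `|f q| <= M.

Local Notation Em f := (\int[mu]_(q in D) f q).

Lemma bmf_integrable f : bmf f -> mu.-integrable D (EFin \o f).
Proof.
move=> [mf [M fM]]; apply: measurable_bounded_integrable => //.
  by rewrite (le_lt_trans (probability_le1 mu mD)) // ltry.
exists M; split; first exact: num_real.
by move=> x Mx y Dy; apply: le_trans (fM y Dy) (ltW Mx).
Qed.

Lemma bmf_cst c : bmf (fun=> c).
Proof. by split; [exact: measurable_cst|exists `|c|]. Qed.

Lemma bmfD f g : bmf f -> bmf g -> bmf (fun q => f q + g q).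
Proof.
move=> [mf [M fM]] [mg [M' gM]]; split; first exact: measurable_funD.
by exists (M + M') => q Dq; apply: le_trans (ler_normD _ _) (lerD (fM _ Dq) (gM _ Dq)).
Qed.

Lemma bmfM f g : bmf f -> bmf g -> bmf (fun q => f q * g q).
Proof.
move=> [mf [M fM]] [mg [M' gM]]; split; first exact: measurable_funM.
exists (M * M') => q Dq; rewrite normrM.
by apply: ler_pM => //; [apply: fM|apply: gM].
Qed.

Lemma bmf_sum (I : Type) (s : seq I) (f : I -> R -> R) :
  (forall a, bmf (f a)) -> bmf (fun q => \sum_(a <- s) f a q).
Proof.
move=> bf; elim: s => [|a s IH].
  by under eq_fun => q do rewrite big_nil; apply: bmf_cst.
by under eq_fun => q do rewrite big_cons; apply: bmfD.
Qed.

Lemma bmf_prod (I : Type) (s : seq I) (f : I -> R -> R) :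
  (forall a, bmf (f a)) -> bmf (fun q => \prod_(a <- s) f a q).
Proof.
move=> bf; elim: s => [|a s IH].
  by under eq_fun => q do rewrite big_nil; apply: bmf_cst.
by under eq_fun => q do rewrite big_cons; apply: bmfM.
Qed.

Lemma Em_cst c : Em (fun=> c) = c.
Proof. by rewrite Rintegral_cst // [X in fine X](_ : _ = 1%E) ?mulr1. Qed.

Lemma EmD f g : bmf f -> bmf g -> Em (fun q => f q + g q) = Em f + Em g.
Proof. by move=> bf bg; rewrite RintegralD //; apply: bmf_integrable. Qed.

Lemma EmZ c f : bmf f -> Em (fun q => c * f q) = c * Em f.
Proof. by move=> bf; rewrite RintegralZl //; apply: bmf_integrable. Qed.

Lemma Em_sum (I : Type) (s : seq I) (c : I -> R) (f : I -> R -> R) :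
  (forall a, bmf (f a)) ->
  Em (fun q => \sum_(a <- s) c a * f a q) = \sum_(a <- s) c a * Em (f a).
Proof.
move=> bf; elim: s => [|a s IH].
  by under eq_Rintegral => q _ do rewrite big_nil; rewrite big_nil Em_cst.
under eq_Rintegral => q _ do rewrite big_cons.
rewrite big_cons EmD ?EmZ ?IH //; first by apply: bmfM => //; apply: bmf_cst.
by apply: bmf_sum => b; apply: bmfM => //; apply: bmf_cst.
Qed.

Lemma le_Em f g : bmf f -> bmf g -> (forall q, D q -> f q <= g q) -> Em f <= Em g.
Proof. by move=> bf bg fg; apply: le_Rintegral => //; apply: bmf_integrable. Qed.

Lemma nonempty_D : exists q, D q.
Proof.
apply/not_existsP => nD; have D0 : D = set0 by apply/seteqP; split => // q /nD.
by move: muD; rewrite D0 measure0 => /eqP; rewrite eq_sym onee_eq0.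
Qed.

(* Integrates the variables [q j] out one at a time. *)
Lemma anneal N (I : Type) (s : seq I) (c : I -> R) (f : I -> nat -> R -> R)
    (g : nat -> R -> R) A0 :
  (forall a j, bmf (f a j)) -> (forall j, bmf (g j)) -> (forall j, Em (g j) = 0) ->
  (forall q : nat -> R, (forall j, D (q j)) ->
    \sum_(a <- s) c a * \prod_(j < N) f a j (q j) <=
      A0 + 2 * (\sum_(j < N) g j (q j)) ^+ 2) ->
  \sum_(a <- s) c a * \prod_(j < N) Em (f a j) <=
    A0 + 2 * \sum_(j < N) Em (fun z => g j z ^+ 2).
Proof.
move=> bf bg g0; elim: N c A0 => [|N IH] c A0 H.
  have [q0 Dq0] := nonempty_D.
  have := H (fun=> q0) (fun=> Dq0); rewrite !big_ord0 expr0n.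
  by under eq_bigr => a _ do rewrite big_ord0;
     under [X in _ -> X <= _]eq_bigr => a _ do rewrite big_ord0.
rewrite big_ord_recr mulrDr [X in _ + X]addrC addrA.
under eq_bigr => a _ do rewrite big_ord_recr mulrA mulrAC.
(* With the first [N] variables fixed, the inequality is integrated in the last one, and
   [Em (f a N)] joins the coefficient. *)
apply: (IH (fun a => c a * Em (f a N))) => q Dq.
set S := \sum_(j < N) g j (q j).
pose k a := c a * \prod_(j < N) f a j (q j).
have bg2 : bmf (fun z => g N z ^+ 2).
  by under eq_fun => z do rewrite expr2; apply: bmfM.
have b1 := bmfM _ _ (bmf_cst (4 * S)) (bg N).
have b2 := bmfM _ _ (bmf_cst 2) bg2.
have -> : \sum_(a <- s) c a * Em (f a N) * \prod_(j < N) f a j (q j) =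
    Em (fun z => \sum_(a <- s) k a * f a N z).
  by rewrite Em_sum //; apply: eq_bigr => a _; rewrite /k; ring.
(* In the expansion of the square, the cross term [4 * S * g N z] integrates to 0. *)
have -> : A0 + 2 * Em (fun z => g N z ^+ 2) + 2 * S ^+ 2 =
    Em (fun z => (A0 + 2 * S ^+ 2) + ((4 * S) * g N z + 2 * g N z ^+ 2)).
  by rewrite (EmD _ _ (bmf_cst _) (bmfD _ _ b1 b2)) (EmD _ _ b1 b2) Em_cst !EmZ // g0; ring.
apply: le_Em.
- by apply: bmf_sum => a; apply: bmfM => //; apply: bmf_cst.
- exact: bmfD (bmf_cst _) (bmfD _ _ b1 b2).
move=> z Dz; pose q' j := if (j < N)%N then q j else z.
have Dq' j : D (q' j) by rewrite /q'; case: ifP.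
have q'N : q' N = z by rewrite /q' ltnn.
have q'E (j : 'I_N) : q' j = q j by rewrite /q' ltn_ord.
have -> : \sum_(a <- s) k a * f a N z =
    \sum_(a <- s) c a * \prod_(j < N.+1) f a j (q' j).
  apply: eq_bigr => a _; rewrite big_ord_recr /= q'N mulrA; congr (_ * _ * _).
  by apply: eq_bigr => j _; rewrite q'E.
apply: le_trans (H q' Dq') _; rewrite big_ord_recr /= q'N.
have -> : \sum_(j < N) g j (q' j) = S by apply: eq_bigr => j _; rewrite q'E.
by rewrite le_eqVlt; apply/orP; left; apply/eqP; ring.
Qed.

End Annealing.

(** * Transfer to the probability space *)

Lemma measure_bigsetU_le {R : realType} {d : measure_display} {T : measurableType d}
    (P : probability T R) (I : Type) (s : seq I) (Q : pred I) (F : I -> set T) :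
  (forall i, measurable (F i)) ->
  (P (\big[setU/set0]_(i <- s | Q i) F i) <= \sum_(i <- s | Q i) P (F i))%E.
Proof.
move=> mF; elim: s => [|a s IH]; first by rewrite !big_nil measure0.
rewrite !big_cons; case: ifP => // _.
apply: le_trans (measureU2 _ _ _) _ => //; first exact: bigsetU_measurable.
exact: leeD2l.
Qed.

Lemma integral_setT_full {R : realType} (mu : probability R R) (D : set R) (f : R -> R) :
  measurable D -> mu D = 1%E -> measurable_fun setT f ->
  (\int[mu]_q (f q)%:E = \int[mu]_(q in D) (f q)%:E)%E.
Proof.
move=> mD muD mf; rewrite [RHS]integral_mkcond.
have mu0 : mu (~` D) = 0%E by rewrite probability_setC // muD subee.
apply: ae_eq_integral => //.
- exact/measurable_EFinP.
- apply/(measurable_restrict _ mD measurableT); rewrite setTI.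
  by apply/measurable_EFinP; apply: measurable_funS mf.
- exists (~` D); split => //; first exact: measurableC.
  move=> q /= H Dq; apply: H => _; rewrite patchE mem_set //.
Qed.

Definition matrix_of N (Y : nat -> nat -> bool) : seq (seq bool) :=
  mkseq (fun j => mkseq (Y^~ j) N) N.

Lemma shaped_matrix_of N Y : shaped N N (matrix_of N Y).
Proof.
rewrite /shaped size_mkseq eqxx /=; apply/allP => x /mapP[j _ ->].
by rewrite size_mkseq.
Qed.

Lemma entries_matrix_of N Y i j : (i < N)%N -> (j < N)%N ->
  entries (matrix_of N Y) i j = Y i j.
Proof. by move=> iN jN; rewrite /entries !nth_mkseq. Qed.

Section Tail.
Context {R : realType} {d : measure_display} {T : measurableType d}.
Context (P : probability T R) (mu : probability R R).
Context (p : nat -> T -> R) (X : nat -> nat -> T -> bool) (D : set R).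
Hypothesis env : random_env P mu p X.
Hypotheses (mD : measurable D) (muD : mu D = 1%E) (D01 : D `<=` `[0, 1]).

Local Notation Em f := (\int[mu]_(q in D) f q).

Lemma D_itv q : D q -> 0 <= q <= 1.
Proof. by move=> /D01; rewrite /= in_itv. Qed.

Lemma bmf_id : bmf D id.
Proof.
split; first exact: measurable_id.
by exists 1 => q /D_itv /andP[q0 q1]; rewrite ger0_norm.
Qed.

Lemma bmf_bern (b : bool) : bmf D (fun q => if b then q else 1 - q).
Proof.
case: b; first exact: bmf_id.
split; first by apply: measurable_funB => //; exact: measurable_id.
by exists 1 => q /D_itv /andP[q0 q1]; rewrite ger0_norm; lra.
Qed.

(** The shape is that of the cylinder formula of [random_env] with [A j] the whole line. *)
Definition cylinder N (x : nat -> nat -> bool) : set T :=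
  [set w | forall j, (j < N)%N -> [set: R] (p j w) /\
     forall i, (i < N)%N -> X i j w = x i j].

Lemma measurable_cylinder N x : measurable (cylinder N x).
Proof.
have [_ _ mX _] := env.
have -> : cylinder N x =
    \bigcap_(j in `I_N) \bigcap_(i in `I_N) [set w | X i j w = x i j].
  apply/seteqP; split=> w /= H; first by move=> j jN i iN; apply: (H j jN).2.
  by move=> j jN; split => // i iN; apply: H.
apply: bigcap_measurableType => j _; apply: bigcap_measurableType => i _.
case: (x i j); first exact: mX.
rewrite [X in measurable X](_ : _ = ~` [set w | X i j w]); first exact/measurableC/mX.
by apply/seteqP; split=> w /=; [move=> ->|move/negP/negbTE].
Qed.

Lemma P_cylinder N x : P (cylinder N x) =
  (\prod_(j < N) Em (fun q => \prod_(i < N) (if x i j then q else 1 - q)))%:E.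
Proof.
have [_ _ _ cyl] := env.
rewrite (cyl N (fun=> setT) x) // -prodEFin; apply: eq_bigr => j _.
have bf : bmf D (fun q => \prod_(i < N) (if x i j then q else 1 - q)).
  by apply: bmf_prod => i; apply: bmf_bern.
rewrite (integral_setT_full mu D) //; last first.
  elim: (index_enum _) => [|i s IH].
    by under eq_fun => q do rewrite big_nil; apply: measurable_cst.
  under eq_fun => q do rewrite big_cons; apply: measurable_funM => //.
  by case: (x i j); [exact: measurable_id|
    apply: measurable_funB; [exact: measurable_cst|exact: measurable_id]].
by rewrite fineK //; apply: integrable_fin_num => //; apply: bmf_integrable.
Qed.

(* [phi] and [pp] allow the rows of the enumerated matrices to be either the rows
   or the columns of the environment. *)
Lemma tail_bound N k l (Y : T -> nat -> nat -> bool)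
    (phi : seq (seq bool) -> nat -> nat -> bool)
    (pp : (nat -> R) -> nat -> nat -> R) (g : nat -> R -> R) (c e A0 : R) :
  (k < N)%N -> (l < N)%N -> 0 < e ->
  (forall w i j, (i < N)%N -> (j < N)%N -> phi (matrix_of N (Y w)) i j = X i j w) ->
  (forall q m,
    \prod_(a < N) \prod_(i < N) (if entries m i a then pp q a i else 1 - pp q a i) =
    \prod_(j < N) \prod_(i < N) (if phi m i j then q j else 1 - q j)) ->
  (forall j, bmf D (g j)) -> (forall j, Em (g j) = 0) ->
  (forall q, (forall j, D (q j)) ->
    e ^+ 2 * Emat l.+1 k.+1 (pp q) (fun m => (c <= (Tright (entries m) k l)%:R)%R%:R)
      <= A0 + 2 * (\sum_(j < N) g j (q j)) ^+ 2) ->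
  exists2 U : set T, measurable U /\ [set w | c <= (Tright (Y w) k l)%:R] `<=` U &
    (P U <= ((A0 + 2 * \sum_(j < N) Em (fun q => g j q ^+ 2)) / e ^+ 2)%:E)%E.
Proof.
move=> kN lN e0 phiP ppE bg g0 H.
pose Q (m : seq (seq bool)) : bool := c <= (Tright (entries m) k l)%:R.
have Qt m : Q [seq take k.+1 x | x <- take l.+1 m] = Q m.
  rewrite /Q; congr (_ <= _%:R); apply: Tright_local => i j ik jl; rewrite /entries.
  have [jm|jm] := ltnP j (size m).
    by rewrite (nth_map [::]) ?nth_take // size_take; case: ifP.
  rewrite !(@nth_default _ [::]) //.
  by rewrite size_map size_take_min (leq_trans (geq_minr _ _) jm).
(* The union of the cylinders of all good square matrices is measurable and contains the event. *)
exists (\big[setU/set0]_(m <- mats N N | Q m) cylinder N (phi m)).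
  split; first by apply: bigsetU_measurable => m _; apply: measurable_cylinder.
  move=> w /= cw; rewrite -bigcup_seq_cond; exists (matrix_of N (Y w)).
    rewrite /= mem_mats ?shaped_matrix_of //= /Q.
    rewrite (Tright_local _ (Y w)) // => i j ik jl.
    by apply: entries_matrix_of; [exact: leq_ltn_trans kN|exact: leq_ltn_trans lN].
  by move=> j jN; split => // i iN; rewrite phiP.
apply: le_trans (measure_bigsetU_le _ _ _ _ _ (fun m => measurable_cylinder N (phi m))) _.
under eq_bigr => m _ do rewrite P_cylinder.
rewrite sumEFin lee_fin ler_pdivlMr ?exprn_gt0 //.
rewrite big_mkcond big_distrl /=.
pose f (m : seq (seq bool)) j q := \prod_(i < N) (if phi m i j then q else 1 - q : R).
have -> : \sum_(m <- mats N N) (if Q m then \prod_(j < N) Em (f m j) else 0) * e ^+ 2 =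
    \sum_(m <- mats N N) (e ^+ 2 * (Q m)%:R) * \prod_(j < N) Em (f m j).
  by apply: eq_bigr => m _; case: (Q m); rewrite ?mulr1 ?mulr0 ?mul0r // mulrC.
(* The union bound has produced a linear combination of products of integrals, with coefficients
   [e ^+ 2 * (Q m)%:R]. *)
apply: anneal => //; first by move=> m j; apply: bmf_prod => i; apply: bmf_bern.
move=> q Dq; apply: le_trans (H q Dq).
rewrite -(Emat_take N _ N) // Emat_sum big_distrr /=.
rewrite le_eqVlt; apply/orP; left; apply/eqP; apply: eq_bigr => m _.
by rewrite -/(Q [seq take k.+1 x | x <- take l.+1 m]) Qt /f -ppE -mulrA [_ * (Q m)%:R]mulrC.
Qed.

End Tail.

(** * Tail estimates for the two directed models *)

Lemma bmfV {R : realType} (D : set R) (f : R -> R) (e : R) : measurable D -> 0 < e ->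
  bmf D f -> (forall q, D q -> e <= f q) -> bmf D (fun q => (f q)^-1).
Proof.
move=> mD e0 [mf _] ef; split; last first.
  exists e^-1 => q Dq; have f0 := lt_le_trans e0 (ef q Dq).
  by rewrite ger0_norm ?invr_ge0 ?(ltW f0) // lef_pV2 ?posrE // ef.
pose E : set R := [set` `]0, +oo[].
have mV : measurable_fun E (GRing.inv : R -> R).
  apply: open_continuous_measurable_fun; first exact: interval_open.
  move=> z; rewrite inE /E /= in_itv /= andbT => z0.
  by apply: inv_continuous; rewrite gt_eqF.
apply: measurable_comp mV mf; first exact: measurable_itv.
by move=> _ [q Dq <-]; rewrite /E /= in_itv /= andbT (lt_le_trans e0 (ef q Dq)).
Qed.

Lemma bmf_gmean {R : realType} (D : set R) (r : R -> R) K :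
  bmf D r -> bmf D (fun q => gmean (r q) K).
Proof.
move=> br; elim: K => [|K IH]; first exact: bmf_cst.
under eq_fun => q do rewrite gmean_S.
by apply: bmfM => //; apply: bmfD => //; apply: bmf_cst.
Qed.

Lemma Em_centered_sqr {R : realType} (mu : probability R R) (D : set R) (f : R -> R) (B : R) :
  measurable D -> mu D = 1%E -> bmf D f -> (forall q, D q -> 0 <= f q <= B) ->
  let m := \int[mu]_(q in D) f q in
  [/\ bmf D (fun q => f q - m), \int[mu]_(q in D) (f q - m) = 0 &
      \int[mu]_(q in D) (f q - m) ^+ 2 <= B ^+ 2].
Proof.
move=> mD muD bf fB m.
have bg : bmf D (fun q => f q - m) by apply: bmfD => //; apply: bmf_cst.
have [q0 Dq0] := nonempty_D mu D muD.
have m0 : 0 <= m.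
  rewrite -(Em_cst mu D mD muD 0); apply: le_Em => //; first exact: bmf_cst.
  by move=> q /fB /andP[].
have mB : m <= B.
  rewrite -(Em_cst mu D mD muD B); apply: le_Em => //; first exact: bmf_cst.
  by move=> q /fB /andP[].
split => //.
  rewrite (EmD mu D mD f (fun=> - m)) //; last exact: bmf_cst.
  by rewrite Em_cst // subrr.
rewrite -(Em_cst mu D mD muD (B ^+ 2)); apply: le_Em => //.
- by under eq_fun => q do rewrite expr2; apply: bmfM.
- exact: bmf_cst.
- move=> q /fB /andP[f0 f1]; rewrite -real_normK ?num_real // ler_sqr ?nnegrE //.
    by rewrite ler_norml; lra.
  exact: le_trans f0 f1.
Qed.

Section Tails.
Context {R : realType} {d : measure_display} {T : measurableType d}.
Context (P : probability T R) (mu : probability R R).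
Context (p : nat -> T -> R) (X : nat -> nat -> T -> bool).
Hypothesis env : random_env P mu p X.

(** A Chebyshev bound around the linear profile with slopes [a] and [b], with one constant for all
    rectangles; the event is enclosed in a measurable set. *)
Definition tail_le (Tf : (nat -> nat -> bool) -> nat -> nat -> nat) (a b : R) : Prop :=
  exists A : R, forall k l (e : R), 0 < e ->
    exists2 U : set T, measurable U /\
      [set w | k.+1%:R * a + l.+1%:R * b + e <= (Tf (fun i j => X i j w) k l)%:R] `<=` U &
      (P U <= (A * (k + l + 2)%:R / e ^+ 2)%:E)%E.

(** The bottom parameter [u] is fixed and each row gets the ratio [r q] solving Burke's relation;
    its geometric mean q (1 - u) / (u - q) is averaged over the environment. *)
Lemma right_tail (b u : R) : 0 <= b -> b < u -> u < 1 -> mu [set` `[0, b]] = 1%E ->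
  tail_le Tright u ((\int[mu]_(q in [set` `[0, b]]) q) * (1 - u) / (u - b)).
Proof.
move=> b0 bu u1 muD; set D := [set` `[0, b]] in muD *.
have mD : measurable D by exact: measurable_itv.
have Db q : D q -> 0 <= q <= b by rewrite /D /= in_itv.
have u0 : 0 < u by apply: le_lt_trans bu.
have D01 : D `<=` `[0, 1].
  by move=> q /Db /andP[q0 qb]; rewrite /= in_itv /=; lra.
have bid : bmf D id := bmf_id D D01.
(* The largest ratio [s] is below 1 because [b < u]; this bounds all geometric moments uniformly. *)
pose r q := q * (1 - u) / (u * (1 - q)); pose s := r b.
have den q : D q -> 0 < u * (1 - q).
  by move=> /Db /andP[q0 qb]; apply: mulr_gt0 => //; lra.
have r0 q : D q -> 0 <= r q.
  move=> Dq; apply: divr_ge0; last exact/ltW/den.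
  by have /andP[q0 qb] := Db q Dq; apply: mulr_ge0; lra.
have Dbb : D b by rewrite /D /= in_itv /= lexx b0.
have s1 : s < 1.
  rewrite ltr_pdivrMr ?den // mul1r; nra.
have rs q : D q -> r q <= s.
  move=> Dq; have /andP[q0 qb] := Db q Dq.
  rewrite ler_pdivrMr ?den // mulrAC ler_pdivlMr ?den //.
  have : 0 <= (1 - u) * u * (b - q) by rewrite !mulr_ge0 //; lra.
  nra.
have br : bmf D r.
  apply: bmfM; first by apply: bmfM => //; apply: bmf_cst.
  apply: (@bmfV _ _ _ (u * (1 - b))) => //; first exact: den.
    by apply: bmfM; [exact: bmf_cst|exact: (bmf_bern D D01 false)].
  by move=> q /Db /andP[q0 qb]; rewrite ler_pM2l //; lra.
pose B := (1 - s)^-1.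
have B0 : 0 < B by rewrite invr_gt0 subr_gt0.
(* Each row contributes [4 * B ^+ 2] from the geometric weights and [2 * B ^+ 2] from the
   environment; each column contributes 1 from the Bernoulli weights. *)
exists (6 * B ^+ 2 + 1) => k l e e0.
pose K := k.+1; pose m q := gmean (r q) K.
have bm : bmf D m := bmf_gmean D r K br.
have mB q : D q -> 0 <= m q <= B.
  move=> Dq; rewrite gmean_ge0 ?r0 //=.
  have rq1 : r q < 1 by apply: le_lt_trans (rs q Dq) s1.
  apply: le_trans (gmean_le _ _ (r0 q Dq) rq1) _.
  rewrite -[B]mul1r; apply: ler_pM; rewrite ?r0 ?invr_ge0 ?subr_ge0 //; [lra|lra|].
  by rewrite lef_pV2 ?posrE ?subr_gt0 // lerD2l lerN2 rs.
have [bg g0 gB] := Em_centered_sqr mu D m B mD muD bm mB.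
set M1 := \int[mu]_(q in D) m q in bg g0 gB.
have M1le : M1 <= (\int[mu]_(q in D) q) * (1 - u) / (u - b).
  rewrite -mulrA mulrC -EmZ //; apply: le_Em => //.
    by apply: bmfM => //; apply: bmf_cst.
  move=> q Dq; have /andP[q0 qb] := Db q Dq.
  have rq1 : r q < 1 by apply: le_lt_trans (rs q Dq) s1.
  apply: le_trans (gmean_le _ _ (r0 q Dq) rq1) _.
  have -> : r q / (1 - r q) = q * (1 - u) / (u - q).
    have uq : u - q != 0 by rewrite gt_eqF //; lra.
    have q1 : 1 - q != 0 by rewrite gt_eqF //; lra.
    have -> : 1 - r q = (u - q) / (u * (1 - q)).
      by rewrite /r; field; rewrite q1 gt_eqF.
    by rewrite /r; field; rewrite q1 uq gt_eqF.
  rewrite -mulrA [leRHS]mulrC; apply: ler_wpM2l => //; apply: ler_wpM2l; first lra.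
  by rewrite lef_pV2 ?posrE; lra.
(* The cylinders are [N] by [N], so the fluctuation is set to 0 for the rows above height [l]. *)
pose g j q := if (j < l.+1)%N then m q - M1 else 0.
pose N := (maxn k l).+1.
have [||||||||U [mU EU] PU] := tail_bound P mu p X D env mD muD D01 N k l
  (fun w i j => X i j w) entries (fun q a _ => q a) g
  (l.+1%:R * M1 + k.+1%:R * u + e) e (4 * l.+1%:R * B ^+ 2 + k.+1%:R).
- by rewrite ltnS leq_maxl.
- by rewrite ltnS leq_maxr.
- exact: e0.
- by move=> w i j iN jN; rewrite entries_matrix_of.
- by [].
- by move=> j; rewrite /g; case: (j < _)%N => //; apply: bmf_cst.
- by move=> j; rewrite /g; case: (j < _)%N => //; rewrite Em_cst.
- move=> q Dq.
  apply: (le_trans (quenched_chebyshev l.+1 k.+1 K (fun a _ => q a)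
    (fun a => r (q a)) (fun=> u) _ (l.+1%:R * M1) (k.+1%:R * u) e _ _ _ _ _ _ _)).
  + by [].
  + exact: ltW.
  + by move=> a i _ _; have := D01 _ (Dq a); rewrite /= in_itv.
  + by move=> a _; rewrite r0 //= (le_trans (rs _ (Dq a))) // ltW.
  + by move=> i _; rewrite (ltW u0) ltW.
  + move=> a i _ _; rewrite /r; have := den _ (Dq a); move: (q a) => z dz.
    have z1 : 1 - z != 0 by apply: contraTneq dz => ->; rewrite mulr0 ltxx.
    by field; rewrite z1 gt_eqF.
  + move=> ns I x sns sI /andP[/eqP sx ax] cT; apply: le_trans cT _.
    by rewrite ler_nat Tright_le_stationary // ?sx ?sns // sI.
  have -> : \sum_(i < k.+1) u - k.+1%:R * u = 0.
    by rewrite sumr_const card_ord mulr_natl subrr.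
  have -> : \sum_(a < l.+1) gmean (r (q a)) K - l.+1%:R * M1 = \sum_(j < N) g j (q j).
    have lN : (l < N)%N by rewrite ltnS leq_maxr.
    rewrite (big_ord_widen _ (fun a => gmean (r (q a)) K) lN) /g.
    rewrite -big_mkcond /= sumrB -/m; congr (_ - _).
    rewrite -(big_ord_widen _ (fun=> M1) lN) sumr_const card_ord.
    by rewrite mulr_natl.
  have h1 : \sum_(a < l.+1) gsqr (r (q a)) K <= l.+1%:R * (2 * B ^+ 2).
    have -> : l.+1%:R * (2 * B ^+ 2) = \sum_(a < l.+1) 2 * B ^+ 2.
      by rewrite sumr_const card_ord mulr_natl.
    apply: ler_sum => a _; rewrite /B exprVn.
    by apply: gsqr_le => //; [exact: r0|exact: rs].
  have h2 : \sum_(i < k.+1) u * (1 - u) <= k.+1%:R / 2.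
    have -> : k.+1%:R / 2 = \sum_(i < k.+1) 2^-1 :> R.
      by rewrite sumr_const card_ord mulr_natl.
    by apply: ler_sum => a _; nra.
  by set S := \sum_(j < N) _; rewrite expr0n /= addr0; lra.
exists U; [split => // w /= h; apply: EU => /=|].
  by apply: le_trans h; have := ler_wpM2l (ler0n R l.+1) M1le; lra.
apply: le_trans PU _; rewrite lee_fin ler_pM2r ?invr_gt0 ?exprn_gt0 //.
have hg : \sum_(j < N) \int[mu]_(q in D) g j q ^+ 2 <= l.+1%:R * B ^+ 2.
  have lN : (l < N)%N by rewrite ltnS leq_maxr.
  have -> : l.+1%:R * B ^+ 2 = \sum_(j < N) (if (j < l.+1)%N then B ^+ 2 else 0).
    rewrite -big_mkcond -(big_ord_widen _ (fun=> B ^+ 2) lN) sumr_const card_ord.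
    by rewrite mulr_natl.
  apply: ler_sum => j _; rewrite /g; case: (j < l.+1)%N => //.
  by rewrite expr0n Em_cst.
have -> : (k + l + 2)%:R = k.+1%:R + l.+1%:R :> R by rewrite -natrD; congr (_%:R); lia.
have : 0 <= k.+1%:R * B ^+ 2 by rewrite mulr_ge0 // sqr_ge0.
have : 0 <= l.+1%:R :> R by [].
by move: hg; set Z := \sum_(j < N) _; lra.
Qed.

(** In the transposed array the environment varies along the rows: the ratio [r] is fixed, and
    Burke's relation gives the bottom parameters [v q]. *)
Lemma up_tail (r : R) : 0 < r -> r < 1 ->
  let pbar := \int[mu]_(q in [set` `[0, 1]]) q in
  tail_le Tup (r / (1 - r)) (pbar / (pbar + r * (1 - pbar))).
Proof.
move=> r0 r1; have [muD _ _ _] := env; set D := [set` `[0, 1]] in muD *.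
move=> pbar.
have mD : measurable D by exact: measurable_itv.
have Db q : D q -> 0 <= q <= 1 by rewrite /D /= in_itv.
have D01 : D `<=` `[0, 1] by [].
have bid : bmf D id := bmf_id D D01.
have pbar01 : 0 <= pbar <= 1.
  apply/andP; split; [rewrite -(Em_cst mu D mD muD 0)|rewrite -(Em_cst mu D mD muD 1)];
  by apply: le_Em => //; try exact: bmf_cst; move=> q /Db /andP[].
pose v q := q / (q + r * (1 - q)).
have den q : 0 <= q <= 1 -> r <= q + r * (1 - q).
  move=> /andP[q0 q1]; have : 0 <= q * (1 - r) by apply: mulr_ge0; lra.
  by lra.
have den0 q : 0 <= q <= 1 -> 0 < q + r * (1 - q).
  by move=> /den; apply: lt_le_trans.
have v01 q : D q -> 0 <= v q <= 1.
  move=> /Db q01; have dq := den0 q q01; have /andP[q0 q1] := q01.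
  rewrite divr_ge0 ?(ltW dq) //= ler_pdivrMr // mul1r lerDl.
  by apply: mulr_ge0; lra.
have bv : bmf D v.
  apply: bmfM => //; apply: (bmfV _ _ _ mD r0) => [|q /Db]; last exact: den.
  by apply: bmfD => //; apply: bmfM; [exact: bmf_cst|exact: (bmf_bern D D01 false)].
have [bg g0 gB] := Em_centered_sqr mu D v 1 mD muD bv v01.
set M2 := \int[mu]_(q in D) v q in bg g0 gB.
have M2le : M2 <= pbar / (pbar + r * (1 - pbar)).
  (* Jensen's inequality by the tangent: [s] is the slope of the concave function [v] at [pbar]. *)
  have dp := den0 _ pbar01; set s := r / (pbar + r * (1 - pbar)) ^+ 2.
  have -> : pbar / (pbar + r * (1 - pbar)) =
      \int[mu]_(q in D) (pbar / (pbar + r * (1 - pbar)) - s * pbar + s * q).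
    rewrite (EmD mu D mD (fun=> _)) ?EmZ ?Em_cst //; last by apply: bmfM => //; apply: bmf_cst.
      by rewrite -/pbar; ring.
    exact: bmf_cst.
  apply: le_Em => //.
    by apply: bmfD; [exact: bmf_cst|apply: bmfM => //; apply: bmf_cst].
  move=> q /Db q01; have dq := den0 _ q01; rewrite -subr_ge0.
  have -> : pbar / (pbar + r * (1 - pbar)) - s * pbar + s * q - v q =
      r * (1 - r) * (q - pbar) ^+ 2 /
      ((pbar + r * (1 - pbar)) ^+ 2 * (q + r * (1 - q))).
    by rewrite /s /v; field; rewrite !gt_eqF.
  apply: divr_ge0; last by rewrite mulr_ge0 ?exprn_ge0 // ltW.
  by rewrite mulr_ge0 ?sqr_ge0 // mulr_ge0; lra.
pose B := (1 - r)^-1.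
have B0 : 0 < B by rewrite invr_gt0 subr_gt0.
(* Each column contributes [4 * B ^+ 2]; each row contributes 1 from the Bernoulli weights and 2
   from the environment, since [v] lies in [0, 1]. *)
exists (4 * B ^+ 2 + 3) => k l e e0.
pose K := l.+1; pose M1 := gmean r K.
have M1le : M1 <= r / (1 - r) by apply: gmean_le => //; exact: ltW.
pose g j q := if (j < l.+1)%N then v q - M2 else 0.
pose N := (maxn k l).+1.
have lN : (l < N)%N by rewrite ltnS leq_maxr.
have kN : (k < N)%N by rewrite ltnS leq_maxl.
have [||||||||U [mU EU] PU] := tail_bound P mu p X D env mD muD D01 N l k
  (fun w i j => X j i w) (fun m i j => entries m j i) (fun q _ i => q i) g
  (k.+1%:R * M1 + l.+1%:R * M2 + e) e (4 * k.+1%:R * B ^+ 2 + l.+1%:R).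
- by [].
- by [].
- exact: e0.
- by move=> w i j iN jN; rewrite entries_matrix_of.
- by move=> q m; rewrite exchange_big.
- by move=> j; rewrite /g; case: (j < _)%N => //; apply: bmf_cst.
- by move=> j; rewrite /g; case: (j < _)%N => //; rewrite Em_cst.
- move=> q Dq.
  apply: (le_trans (quenched_chebyshev k.+1 l.+1 K (fun _ i => q i)
    (fun=> r) (fun i => v (q i)) _ (k.+1%:R * M1) (l.+1%:R * M2) e _ _ _ _ _ _ _)).
  + by [].
  + exact: ltW.
  + by move=> a i _ _; exact: Db.
  + by move=> a _; rewrite (ltW r0) ltW.
  + by move=> i _; exact: v01.
  + move=> a i _ _; rewrite /v; have := den0 _ (Db _ (Dq i)); move: (q i) => z dz.
    by field; rewrite gt_eqF.
  + move=> ns I x sns sI /andP[/eqP sx ax] cT; apply: le_trans cT _.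
    by rewrite ler_nat Tright_le_stationary // ?sx ?sns // sI.
  have -> : \sum_(a < k.+1) gmean r K - k.+1%:R * M1 = 0.
    by rewrite sumr_const card_ord mulr_natl subrr.
  have -> : \sum_(i < l.+1) v (q i) - l.+1%:R * M2 = \sum_(j < N) g j (q j).
    rewrite (big_ord_widen _ (fun a => v (q a)) lN) /g.
    rewrite -big_mkcond /= sumrB; congr (_ - _).
    by rewrite -(big_ord_widen _ (fun=> M2) lN) sumr_const card_ord mulr_natl.
  have h1 : \sum_(a < k.+1) gsqr r K <= k.+1%:R * (2 * B ^+ 2).
    rewrite sumr_const card_ord -[leLHS]mulr_natl ler_wpM2l // /B exprVn.
    by apply: gsqr_le => //; exact: ltW.
  have h2 : \sum_(i < l.+1) v (q i) * (1 - v (q i)) <= l.+1%:R / 2.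
    have -> : l.+1%:R / 2 = \sum_(i < l.+1) 2^-1 :> R.
      by rewrite sumr_const card_ord mulr_natl.
    by apply: ler_sum => a _; nra.
  by set S := \sum_(j < N) _; rewrite expr0n /= addr0; lra.
exists U; [split => // w /= h; apply: EU => /=|].
  apply: le_trans h; have := ler_wpM2l (ler0n R k.+1) M1le.
  by have := ler_wpM2l (ler0n R l.+1) M2le; lra.
apply: le_trans PU _; rewrite lee_fin ler_pM2r ?invr_gt0 ?exprn_gt0 //.
have hg : \sum_(j < N) \int[mu]_(q in D) g j q ^+ 2 <= l.+1%:R.
  have -> : l.+1%:R = \sum_(j < N) (if (j < l.+1)%N then 1 else 0) :> R.
    by rewrite -big_mkcond -(big_ord_widen _ (fun=> 1) lN) sumr_const card_ord.
  apply: ler_sum => j _; rewrite /g; case: (j < l.+1)%N; first by rewrite -(expr1n _ 2).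
  by rewrite expr0n Em_cst.
have -> : (k + l + 2)%:R = k.+1%:R + l.+1%:R :> R by rewrite -natrD; congr (_%:R); lia.
have : 0 <= l.+1%:R * B ^+ 2 by rewrite mulr_ge0 // sqr_ge0.
have : 0 <= k.+1%:R :> R by [].
by move: hg; set Z := \sum_(j < N) _; lra.
Qed.

End Tails.

(** * From tail bounds to almost sure limits *)

Section Limits.
Context {R : realType} {d : measure_display} {T : measurableType d}.
Context (P : probability T R) (X : nat -> nat -> T -> bool).

(** Each column contributes at most 1; this covers the case where the optimal parameter would reach
    1. *)
Lemma right_tail_trivial : tail_le P X Tright 1 0.
Proof.
exists 0 => k l e e0; exists set0; last by rewrite measure0 mul0r mul0r.
split => // w /=; rewrite mulr0 addr0 mulr1 => h.
have : (Tright (fun i j => X i j w) k l)%:R <= k.+1%:R :> R by rewrite ler_nat Tright_le.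
by lra.
Qed.

Lemma up_tail_trivial : tail_le P X Tup 0 1.
Proof.
exists 0 => k l e e0; exists set0; last by rewrite measure0 mul0r mul0r.
split => // w /=; rewrite mulr0 add0r mulr1 => h.
have : (Tup (fun i j => X i j w) k l)%:R <= l.+1%:R :> R by rewrite ler_nat Tup_Tright Tright_le.
by lra.
Qed.

(** At deviations of order n the tail bound is of order 1/n, which is not summable; but a limit
    above [c] forces [E n] for all large [n], and such an intersection is null. *)
Lemma limit_le Tf (a b x y c : R) (Psi : T -> R) : 0 <= a -> 0 <= b ->
  0 < x -> 0 < y -> tail_le P X Tf a b -> x * a + y * b < c ->
  (\forall w \ae P, rescaled (Tf (fun i j => X i j w)) x y @ \oo --> Psi w) ->
  \forall w \ae P, Psi w <= c.
Proof.
move=> a0 b0 x0 y0 [A tA] xyc cvgT.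
pose e := c - (x * a + y * b); have e0 : 0 < e by rewrite subr_gt0.
pose E n : set T := [set w | c <= rescaled (Tf (fun i j => X i j w)) x y n].
(* From [n0] on, [n%:R * e / 2] absorbs the extra [a + b] due to [k.+1] and [l.+1]. *)
pose n0 := (Num.truncn (2 * (a + b) / e)).+1.
pose C := 4 * `|A| * (x + y + 2) / e ^+ 2.
have HU n : exists U : set T, [/\ measurable U, E n `<=` U &
    (n0 <= n)%N -> (P U <= (C / n%:R)%:E)%E].
  have [n0n|nn0] := leqP n0 n; last by exists setT; split => //; rewrite leqNgt nn0.
  have nR : 2 * (a + b) / e < n%:R.
    apply: lt_le_trans (_ : n0%:R <= _); last by rewrite ler_nat.
    exact: truncnS_gt.
  have n1 : 1 <= n%:R :> R by rewrite (ler_nat _ 1); apply: leq_trans n0n.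
  have n_gt0 : 0 < n%:R :> R by apply: lt_le_trans n1.
  set k := Num.truncn (n%:R * x); set l := Num.truncn (n%:R * y).
  have kx : k%:R <= n%:R * x by rewrite truncn_le // mulr_ge0 // ltW.
  have ly : l%:R <= n%:R * y by rewrite truncn_le // mulr_ge0 // ltW.
  have en0 : 0 < n%:R * e / 2 by rewrite divr_gt0 // mulr_gt0.
  have [U [mU EU] PU] := tA k l _ en0.
  exists U; split => //.
    move=> w; rewrite /E /= /rescaled ler_pdivlMr // -/k -/l => cT; apply: EU => /=.
    apply: le_trans cT.
    have h1 : k.+1%:R * a <= (n%:R * x + 1) * a.
      by rewrite ler_wpM2r // -natr1 lerD2r.
    have h2 : l.+1%:R * b <= (n%:R * y + 1) * b.
      by rewrite ler_wpM2r // -natr1 lerD2r.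
    have h3 : 2 * (a + b) < n%:R * e by move: nR; rewrite ltr_pdivrMr.
    have -> : c = e + (x * a + y * b) by rewrite /e; ring.
    by lra.
  move=> _; apply: le_trans PU _; rewrite lee_fin.
  have -> : C / n%:R = `|A| * (n%:R * (x + y + 2)) / (n%:R * e / 2) ^+ 2.
    by rewrite /C; field; rewrite !gt_eqF.
  rewrite ler_pM2r ?invr_gt0 ?exprn_gt0 //.
  apply: (@le_trans _ _ (`|A| * (k + l + 2)%:R)); first by rewrite ler_wpM2r // ler_norm.
  apply: ler_wpM2l => //; rewrite !natrD; lra.
pose U n := sval (cid (HU n)).
have [mU EU PU] : [/\ forall n, measurable (U n), forall n, E n `<=` U n &
    forall n, (n0 <= n)%N -> (P (U n) <= (C / n%:R)%:E)%E].
  by split=> n; rewrite /U; case: cid => V [].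
(* Its probability is at most [C / n%:R] for every large [n], hence zero. *)
pose V m := \bigcap_(n in [set n | (m <= n)%N]) U n.
have mV m : measurable (V m) by apply: bigcap_measurableType => n _; exact: mU.
have PV m : P (V m) = 0%E.
  have Vfin : P (V m) \is a fin_num by exact: fin_num_measure.
  have Vle n : (maxn m n0 <= n)%N -> fine (P (V m)) <= C / n%:R.
    rewrite geq_max => /andP[mn n0n]; rewrite -lee_fin fineK //.
    apply: le_trans (PU n n0n); apply: le_measure; rewrite ?inE //.
    exact: bigcap_inf.
  have V0 : 0 <= fine (P (V m)) by apply: fine_ge0.
  rewrite -(fineK Vfin); congr (_%:E); apply/eqP; rewrite eq_le V0 andbT.
  rewrite leNgt; apply/negP => Vpos.
  pose n := (maxn (maxn m n0) (Num.truncn (C / fine (P (V m)))).+1).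
  have := Vle n (leq_maxl _ _); apply/negP; rewrite -ltNge.
  have Cn : C / fine (P (V m)) < n%:R.
    apply: lt_le_trans (truncnS_gt _) _; rewrite ler_nat; exact: leq_maxr.
  have n_gt0 : 0 < n%:R :> R.
    by rewrite ltr0n /n; apply: leq_trans (leq_maxr _ _).
  by rewrite ltr_pdivrMr // mulrC -ltr_pdivrMr.
have aeV : \forall w \ae P, forall m, ~ V m w.
  by apply: ae_foralln => m; exists (V m); split; [exact: mV|exact: PV|move=> w /= /contrapT].
apply: filterS2 aeV cvgT => w nV cw; rewrite leNgt; apply/negP => cPsi.
have : \forall n \near \oo, c < rescaled (Tf (fun i j => X i j w)) x y n.
  by apply: (cvgr_gt _ cw).
move=> [m _ Hm]; apply: (nV m) => n /= mn; apply: EU; rewrite /E /=.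
exact/ltW/Hm.
Qed.

Lemma ae_le_addgt0 (Psi : T -> R) (c : R) :
  (forall e, 0 < e -> \forall w \ae P, Psi w <= c + e) -> \forall w \ae P, Psi w <= c.
Proof.
move=> H.
have : \forall w \ae P, forall n, Psi w <= c + n.+1%:R^-1.
  by apply: ae_foralln => n; apply: H; rewrite invr_gt0.
apply: filterS => w Hw; rewrite leNgt; apply/negP => /ltr_add_invr[n].
by rewrite ltNge Hw.
Qed.

End Limits.

Lemma full_measure_ae {R : realType} (mu : probability R R) (D : set R) :
  measurable D -> (\forall q \ae mu, D q) -> mu D = 1%E.
Proof.
move=> mD [N [mN N0 DN]].
have : mu (~` D) = 0%E by apply: (subset_measure0 _ mN) => //; apply: measurableC.
rewrite probability_setC // => /eqP; rewrite sube_eq ?fin_num_measure //.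
by rewrite add0e eq_sym => /eqP.
Qed.

Lemma full_measure_ae_inv {R : realType} (mu : probability R R) (D : set R) :
  measurable D -> mu D = 1%E -> \forall q \ae mu, D q.
Proof.
move=> mD muD; exists (~` D); split => //; first exact: measurableC.
have : mu (~` D) = 0%E by rewrite probability_setC // muD subee.
by [].
Qed.

(** * Optimisation of the parameters *)

Section Optimisation.
Context {R : realType}.

(** With u = b + t the expression is b x + t x + pb (1 - b) y / t - pb y. With S the square root in
    [C], the minimiser t = S / x gives at most [C]; if it makes u at least 1, then [x <= C]. *)
Lemma right_parameter (pb b x y e : R) : 0 <= pb -> b <= 1 -> 0 < x -> 0 < y -> 0 < e ->
  let C := b * x + 2 * Num.sqrt (pb * (1 - b) * x * y) in
  x <= C \/ exists u, [/\ b < u, u < 1 & x * u + y * (pb * (1 - u) / (u - b)) < C + e].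
Proof.
move=> pb0 b1 x0 y0 e0 C; rewrite /C.
have W0 : 0 <= pb * (1 - b) * x * y by rewrite !mulr_ge0 // ?subr_ge0 // ltW.
have S0 := sqrtr_ge0 (pb * (1 - b) * x * y); have := sqr_sqrtr W0.
set S := Num.sqrt _ in S0 * => S2.
have [hS|hS] := leP ((1 - b) * x) S; first by left; nra.
(* The shift [h] keeps [u] above [b] even when [S] is 0, leaves it below 1, and costs at most
   [e / 2]. *)
right; pose h := Num.min (e / 2) (((1 - b) * x - S) / 2).
have h0 : 0 < h by rewrite lt_min !divr_gt0 // subr_gt0.
have he : h <= e / 2 by rewrite ge_min lexx.
have hx : h <= ((1 - b) * x - S) / 2 by rewrite ge_min lexx orbT.
have Sh : 0 < S + h by lra.
exists (b + (S + h) / x); have dx : 0 < (S + h) / x by apply: divr_gt0.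
have du : (S + h) / x < 1 - b by rewrite ltr_pdivrMr //; lra.
split; [lra|lra|].
rewrite mulrDr [x * (_ / x)]mulrCA mulfV ?gt_eqF // mulr1.
have -> : b + (S + h) / x - b = (S + h) / x by ring.
suff : y * (pb * (1 - (b + (S + h) / x)) / ((S + h) / x)) <= S by lra.
have -> : y * (pb * (1 - (b + (S + h) / x)) / ((S + h) / x)) =
    (pb * (1 - b) * x * y - y * pb * (S + h)) / (S + h).
  by field; rewrite !gt_eqF.
rewrite ler_pdivrMr // -S2; have : 0 <= y * pb * (S + h) by rewrite !mulr_ge0 // ltW.
have : 0 <= S * h by rewrite mulr_ge0 // ltW.
by nra.
Qed.

(** In the variable v = pb / (pb + r (1 - pb)) one has r / (1 - r) = pb (1 - v) / (v - pb), so the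
    previous optimisation applies with v - pb for t and [x], [y] exchanged. *)
Lemma up_parameter (pb x y e : R) : 0 <= pb -> pb <= 1 -> 0 < x -> 0 < y -> 0 < e ->
  let C := pb * y + 2 * Num.sqrt (pb * (1 - pb) * x * y) in
  y <= C \/ exists r, [/\ 0 < r, r < 1 &
    x * (r / (1 - r)) + y * (pb / (pb + r * (1 - pb))) < C + e].
Proof.
move=> pb0 pb1 x0 y0 e0 C; rewrite /C.
have W0 : 0 <= pb * (1 - pb) * x * y by rewrite !mulr_ge0 // ?subr_ge0 // ltW.
have S0 := sqrtr_ge0 (pb * (1 - pb) * x * y); have := sqr_sqrtr W0.
set S := Num.sqrt _ in S0 * => S2.
have [hS|hS] := leP ((1 - pb) * y) S; first by left; nra.
(* For [pb = 0] the change of variable degenerates, and a small [r] is chosen directly. *)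
right; have [pbE|pbN] := eqVneq pb 0.
  exists (e / (2 * x + 2 * e)); have den : 0 < 2 * x + 2 * e by lra.
  have r1 : e / (2 * x + 2 * e) < 1 by rewrite ltr_pdivrMr //; lra.
  split => //; first exact: divr_gt0.
  rewrite pbE mul0r !mulr0 addr0 mul0r.
  have -> : x * (e / (2 * x + 2 * e) / (1 - e / (2 * x + 2 * e))) = x * e / (2 * x + e).
    by field; rewrite !gt_eqF //; lra.
  by rewrite ltr_pdivrMr; nra.
have {pbN}pb_gt0 : 0 < pb by rewrite lt_neqAle eq_sym pbN.
pose h := Num.min (e / 2) (((1 - pb) * y - S) / 2).
have h0 : 0 < h by rewrite lt_min !divr_gt0 // subr_gt0.
have he : h <= e / 2 by rewrite ge_min lexx.
have hy : h <= ((1 - pb) * y - S) / 2 by rewrite ge_min lexx orbT.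
have Sh : 0 < S + h by lra.
pose dl := (S + h) / y; have dl0 : 0 < dl by apply: divr_gt0.
have du : dl < 1 - pb by rewrite ltr_pdivrMr //; lra.
pose v := pb + dl.
have v0 : 0 < v by rewrite addr_gt0.
have pb1' : 0 < 1 - pb by lra.
have den : 0 < v * (1 - pb) by rewrite mulr_gt0.
exists (pb * (1 - v) / (v * (1 - pb))); split.
- by rewrite divr_gt0 // mulr_gt0 //; rewrite /v; lra.
- by rewrite ltr_pdivrMr // mul1r; rewrite /v; nra.
have -> : pb / (pb + pb * (1 - v) / (v * (1 - pb)) * (1 - pb)) = v.
  have -> : pb + pb * (1 - v) / (v * (1 - pb)) * (1 - pb) = pb / v.
    by field; rewrite !gt_eqF.
  by field; rewrite !gt_eqF.
have -> : pb * (1 - v) / (v * (1 - pb)) / (1 - pb * (1 - v) / (v * (1 - pb))) =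
    pb * (1 - v) / dl.
  have -> : 1 - pb * (1 - v) / (v * (1 - pb)) = dl / (v * (1 - pb)).
    by rewrite /v; field; rewrite -/v !gt_eqF.
  by field; rewrite !gt_eqF.
have -> : y * v = pb * y + (S + h) by rewrite /v /dl; field; rewrite gt_eqF.
suff : x * (pb * (1 - v) / dl) <= S by lra.
have -> : x * (pb * (1 - v) / dl) = (pb * (1 - pb) * x * y - x * pb * (S + h)) / (S + h).
  by rewrite /v /dl; field; rewrite !gt_eqF.
rewrite ler_pdivrMr // -S2; have : 0 <= x * pb * (S + h) by rewrite !mulr_ge0 // ltW.
have : 0 <= S * h by rewrite mulr_ge0 // ltW.
by nra.
Qed.

End Optimisation.

(** * The essential supremum and the three bounds *)

Lemma ess_sup_environment {R : realType} (mu : probability R R) :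
  mu [set` `[0%R, 1%R]] = 1%E ->
  let b := fine (ess_sup mu (fun q : R => q%:E)) in
  [/\ 0 <= b, b <= 1 & mu [set` `[0%R, b]] = 1%E].
Proof.
move=> mu01 b.
have ae01 : \forall q \ae mu, [set` `[0%R, 1%R]] q.
  by apply: full_measure_ae_inv => //; exact: measurable_itv.
(* The bounds 0 and 1 make the essential supremum finite, so [fine] loses nothing. *)
have le1 : (ess_sup mu (fun q : R => q%:E) <= 1%:E)%E.
  by apply/ess_supP; apply: filterS ae01 => q /=; rewrite in_itv /= lee_fin => /andP[].
have muT : (0 < mu setT)%E by rewrite probability_setT.
have ge0 : (0%:E <= ess_sup mu (fun q : R => q%:E))%E.
  by apply: ess_sup_gee => //; apply: filterS ae01 => q /=; rewrite in_itv /= lee_fin => /andP[].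
have bE : ess_sup mu (fun q : R => q%:E) = b%:E.
  by rewrite /b fineK // fin_real // (lt_le_trans _ ge0) ?ltNyr // (le_lt_trans le1) // ltry.
split; [by rewrite -lee_fin -bE|by rewrite -lee_fin -bE|].
apply: full_measure_ae; first exact: measurable_itv.
apply: filterS2 ae01 (ess_sup_ge mu (fun q : R => q%:E)) => q /=.
by rewrite bE lee_fin !in_itv /= => /andP[-> _] ->.
Qed.

Theorem theorem3p2 (R : realType) (d : measure_display) (T : measurableType d)
  (P : probability T R) (mu : probability R R)
  (p : nat -> T -> R) (X : nat -> nat -> T -> bool)
  (x y : R) (Psi_r Psi_u Psi : T -> R) :
  random_env P mu p X -> 0 < x -> 0 < y ->
  let b := fine (ess_sup mu (fun q : R => q%:E)) in
  let pbar := fine (\int[mu]_q q%:E)%E in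
  (\forall w \ae P,
     rescaled (Tright (fun i j => X i j w)) x y @ \oo --> Psi_r w) ->
  (\forall w \ae P,
     rescaled (Tup (fun i j => X i j w)) x y @ \oo --> Psi_u w) ->
  (\forall w \ae P,
     rescaled (Tnn (fun i j => X i j w)) x y @ \oo --> Psi w) ->
  [/\ \forall w \ae P, Psi_r w <= b * x + 2 * Num.sqrt (pbar * (1 - b) * x * y),
      \forall w \ae P, Psi_u w <= pbar * y + 2 * Num.sqrt (pbar * (1 - pbar) * x * y) &
      \forall w \ae P, Psi w <= pbar * y + 4 * Num.sqrt (pbar * (1 - pbar) * x * y) + b * x].
Proof.
move=> env x0 y0 b pbar cvg_r cvg_u cvg_nn.
have [mu01 _ _ _] := env.
have [b0 b1 mub] := ess_sup_environment mu mu01; rewrite -/b in b0 b1 mub.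
have m01 : measurable [set` `[0%R, 1%R] : interval R] by exact: measurable_itv.
have m0b : measurable [set` `[0%R, b]] by exact: measurable_itv.
have pbarE1 : pbar = \int[mu]_(q in [set` `[0%R, 1%R]]) q.
  by rewrite /pbar /Rintegral (integral_setT_full mu [set` `[0%R, 1%R]] id).
have pbarEb : pbar = \int[mu]_(q in [set` `[0%R, b]]) q.
  by rewrite /pbar /Rintegral (integral_setT_full mu [set` `[0%R, b]] id).
have bid : bmf [set` `[0%R, b]] id.
  apply: bmf_id => q /=; rewrite !in_itv /= => /andP[-> qb].
  exact: le_trans qb b1.
have pbar0 : 0 <= pbar.
  rewrite pbarEb -[leLHS](Em_cst mu _ m0b mub 0); apply: le_Em => //; first exact: bmf_cst.
  by move=> q /=; rewrite in_itv => /andP[].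
have pbarb : pbar <= b.
  rewrite pbarEb -[leRHS](Em_cst mu _ m0b mub b); apply: le_Em => //; first exact: bmf_cst.
  by move=> q /=; rewrite in_itv => /andP[].
have pbar1 : pbar <= 1 by apply: le_trans b1.
have Hr : \forall w \ae P, Psi_r w <= b * x + 2 * Num.sqrt (pbar * (1 - b) * x * y).
  apply: ae_le_addgt0 => e e0.
  (* Either the target is at least the trivial bound [x], or some [u] attains it up to [e]. *)
  have [xC|[u [bu u1 uC]]] := right_parameter pbar b x y e pbar0 b1 x0 y0 e0.
    by apply: (limit_le P X Tright 1 0 x y _ Psi_r) cvg_r => //;
      [exact: right_tail_trivial|lra].
  apply: (limit_le P X Tright u (pbar * (1 - u) / (u - b)) x y _ Psi_r) cvg_r => //.
  - lra.
  - by rewrite divr_ge0 ?mulr_ge0 ?subr_ge0 // ltW.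
  - by rewrite pbarEb; apply: right_tail env _ _ _ _ _ _.
have Hu : \forall w \ae P, Psi_u w <= pbar * y + 2 * Num.sqrt (pbar * (1 - pbar) * x * y).
  apply: ae_le_addgt0 => e e0.
  have [yC|[r [r0 r1 rC]]] := up_parameter pbar x y e pbar0 pbar1 x0 y0 e0.
    by apply: (limit_le P X Tup 0 1 x y _ Psi_u) cvg_u => //;
      [exact: up_tail_trivial|lra].
  apply: (limit_le P X Tup (r / (1 - r)) (pbar / (pbar + r * (1 - pbar))) x y _ Psi_u) cvg_u => //.
  - by rewrite divr_ge0 ?subr_ge0 // ltW.
  - by rewrite divr_ge0 // addr_ge0 // mulr_ge0 ?subr_ge0 // ltW.
  - by rewrite pbarE1; apply: up_tail env _ _ _.
split => //.
have Hnn : \forall w \ae P, Psi w <= Psi_r w + Psi_u w.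
  apply: filterS3 cvg_r cvg_u cvg_nn => w cr cu cn.
  apply: (ler_cvg_to cn (cvgD cr cu)); apply: nearW => n.
  change (rescaled (Tnn (fun i j => X i j w)) x y n <=
    rescaled (Tright (fun i j => X i j w)) x y n + rescaled (Tup (fun i j => X i j w)) x y n).
  by rewrite /rescaled -mulrDl ler_wpM2r ?invr_ge0 // -natrD ler_nat Tnn_le.
apply: filterS3 Hr Hu Hnn => w hr hu hnn.
(* Since [pbar <= b], the first root is at most the second, whence the factor 4. *)
have : Num.sqrt (pbar * (1 - b) * x * y) <= Num.sqrt (pbar * (1 - pbar) * x * y).
  rewrite ler_wsqrtr // !ler_wpM2r ?(ltW x0) ?(ltW y0) // ler_wpM2l //.
  by rewrite lerD2l lerN2.
by lra.
Qed.
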